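(* Let $n\ge 0$, let $\mathbf m:[n]\to\mathbb Z_{\ge 0}$ be a reverse Hessenberg function, let $P_{\mathbf m}$ be the associated natural unit interval order, and let $\lambda\vdash n$. Then for each $T\in\mathrm{HikSYT}(\mathbf m,\lambda)$ there exists a function $h_T(q)$ which is a quotient of products of $q$-integers, such that $0<h_T(\tau)\le 1$ for all real $\tau\ge 0$, and $$\frac{c_\lambda^{P_{\mathbf m}}(q)}{[\lambda]_q!}=\sum_{T\in\mathrm{HikSYT}(\mathbf m,\lambda)}q^{\mathrm{inv}_{P_{\mathbf m}}(T)}\,h_T(q).$$
   Context: $[m]_q=1+q+\dots+q^{m-1}$ (a $q$-integer), $[m]_q!=[m]_q[m-1]_q\cdots[1]_q$, and $[\lambda]_q!=\prod_i[\lambda_i]_q!$. A reverse Hessenberg function is $\mathbf m:[n]\to\mathbb Z_{\ge0}$ with $\mathbf m(i)<i$ for all $i$ and $\mathbf m(i)\le \mathbf m(i+1)$. $P_{\mathbf m}$ is the poset on $[n]$ with $i<_{P_{\mathbf m}} j$ iff $i\le \mathbf m(j)$. For $k<n$, $\mathbf m^{(k)}$ is the restriction of $\mathbf m$ to $[k]$. For a poset $P$ on $[n]$, $\mathrm{inc}(P)$ is the graph on $[n]$ with edges between distinct incomparable elements. For a graph $G$ on $[n]$, $X_G(\mathbf x,q)=\sum_\kappa q^{\mathrm{inv}_G(\kappa)}x_{\kappa(1)}\cdots x_{\kappa(n)}$ over proper colorings $\kappa:[n]\to\mathbb Z_{>0}$, where $\mathrm{inv}_G(\kappa)=\#\{\{i,j\}\in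 E(G): i<j,\ \kappa(i)>\kappa(j)\}$. For $P=P_{\mathbf m}$ this is symmetric in $\mathbf x$, and $c_\lambda^{P}(q)$ is the coefficient of the elementary symmetric function $e_\lambda(\mathbf x)$ in $X_{\mathrm{inc}(P)}(\mathbf x,q)$. For a filling $T$ using each element of $[n]$ once, $\mathrm{inv}_P(T)=\#\{(i<j): i,j\text{ incomparable in }P,\ i\text{ appears in a column strictly to the right of the column of }j\text{ in }T\}$. Entries of standard Young tableaux are viewed as elements of $P_{\mathbf m}$. Hikita tableaux: let $T$ be a standard Young tableau (English convention) with $n$ cells, $0\le r\le n$, and let $t_i$ be the largest entry of column $i$ of $T$ ($t_i=0$ if the column is empty). Let $\delta^{(r)}(T)=(\delta_1,\dots,\delta_{n+1})$ with $\delta_i=1$ if $t_i>r$ and $\delta_i=0$ otherwise, and write it in blocks as $(1^{b_0},0^{a_1},1^{b_1},\dots,1^{b_\ell},0^{a_{\ell+1}})$ with $b_0\ge0$ and all other $a_i,b_i\ge 1$. For $0\le k\le \ell$ let $f_k^{(r)}(T)$ be the standard Young tableau obtained by adding $n+1$ at the bottom of column $1+\sum_{i=1}^k a_i+\sum_{i=0}^k b_i$ of $T$, and $$\varphi_k^{(r)}(T;q)=q^{\sum_{i=1}^k a_i}\prod_{i=1}^k\frac{\left[\sum_{j=i+1}^k a_j+\sum_{j=i}^k b_j\right]_q}{\left[\sum_{j=i}^k a_j+\sum_{j=i}^k b_j\right]_q}\prod_{i=k+1}^{\ell}\frac{\left[\sum_{j=k+1}^i a_j+\sum_{j=k+1}^{i-1}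 b_j\right]_q}{\left[\sum_{j=k+1}^i a_j+\sum_{j=k+1}^{i} b_j\right]_q}.$$ For $T$ standard with $n$ cells define the rational function $\mathrm{prob}_{\mathbf m}(T;q)$ recursively: it is $1$ if $n=0$; it is $\varphi_k^{(r)}(S;q)\,\mathrm{prob}_{\mathbf m^{(n-1)}}(S;q)$ if $T=f_k^{(r)}(S)$ for some $k$ and standard $S$ with $n-1$ cells, where $r=\mathbf m(n)$; and it is $0$ otherwise. $\mathrm{HikSYT}(\mathbf m,\lambda)$ is the set of standard Young tableaux $T$ of shape $\lambda$ with $\mathrm{prob}_{\mathbf m}(T;q)\ne 0$. *)

(* Defs.v *)
From HB Require Import structures.
From mathcomp Require Import all_boot all_order all_algebra.
From mathcomp Require Import mpoly.
From mathcomp Require Import boolp classical_sets fsbigop reals.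

Set Implicit Arguments.
Unset Strict Implicit.
Unset Printing Implicit Defensive.

Import Order.TTheory GRing.Theory Num.Theory.

(* Convention: the set [n] = {1, ..., n} is represented by 'I_n, the ordinal  *)
(* i standing for i.+1.  Rows and columns of tableaux are numbered from 0.    *)

Definition is_partition (n : nat) (lam : seq nat) : bool :=
  [&& sorted geq lam, all (leq 1) lam & sumn lam == n].

(* A function on [n] is represented by a function on nat, of which only the   *)
(* values at 1, ..., n are ever used; in particular the restriction of m to   *)
(* [k] is m itself, considered on [k].                                        *)
Definition reverse_hessenberg (n : nat) (m : nat -> nat) : Prop :=
  (forall i, 1 <= i <= n -> m i < i) /\
  (forall i, 1 <= i < n -> m i <= m i.+1).

Definition hess_poset (n : nat) (m : nat -> nat) : rel 'I_n :=
  fun i j => i.+1 <= m j.+1.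

Definition inc (n : nat) (P : rel 'I_n) : rel 'I_n :=
  fun i j => [&& i != j, ~~ P i j & ~~ P j i].

(* A filling in English convention: the list of its rows, from top to bottom. *)
Definition tableau := seq (seq nat).

Definition shape (T : tableau) : seq nat := map size T.

(* As row lengths decrease, zip up down pairs each cell of the row down with  *)
(* the cell above it.                                                         *)
Definition standard (n : nat) (T : tableau) : bool :=
  [&& is_partition n (shape T),
      perm_eq (flatten T) (iota 1 n),
      all (sorted ltn) T &
      sorted (fun up down => all (fun xy => xy.1 < xy.2) (zip up down)) T].

Definition column_of (T : tableau) (i : nat) : nat :=
  index i (nth [::] T (find (fun row => i \in row) T)).

Definition column_height (T : tableau) (c : nat) : nat :=
  count (fun row => c < size row) T.

(* The largest entry of column c, and 0 if the column is empty (entries that  *)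
(* are outside of the tableau read as 0).                                     *)
Definition column_max (T : tableau) (c : nat) : nat :=
  \max_(row <- T) nth 0 row c.

Definition put (T : tableau) (r c x : nat) : tableau :=
  set_nth [::] T r (set_nth 0 (nth [::] T r) c x).

Definition add_bottom (T : tableau) (c x : nat) : tableau :=
  put T (column_height T c) c x.

Definition erase (T : tableau) (x : nat) : tableau :=
  [seq row <- [seq rem x row | row <- T] | row != [::]].

Definition tableau_inv (n : nat) (P : rel 'I_n) (T : tableau) : nat :=
  #|[set ij : 'I_n * 'I_n | [&& ij.1 < ij.2, inc P ij.1 ij.2
                              & column_of T ij.2.+1 < column_of T ij.1.+1]]|.

Definition delta (n r : nat) (T : tableau) : seq bool :=
  [seq r < column_max T c | c <- iota 0 n.+1].

(* Lengths of the maximal runs of s, the first one (possibly of length 0)     *)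
(* being made of bits x and already containing k of them.                     *)
Fixpoint run_lengths (x : bool) (k : nat) (s : seq bool) : seq nat :=
  if s is y :: s' then
    if y == x then run_lengths x k.+1 s' else k :: run_lengths y 1 s'
  else [:: k].

(* [:: b_0; a_1; b_1; ...; b_l; a_(l+1)]: the last bit of delta is always 0,  *)
(* as column n+1 of a standard tableau with n cells is empty.                 *)
Definition blocks (n r : nat) (T : tableau) : seq nat :=
  run_lengths true 0 (delta n r T).

Definition blk_b (n r : nat) (T : tableau) (i : nat) : nat :=
  nth 0 (blocks n r T) i.*2.

(* Meaningful for i >= 1 only. *)
Definition blk_a (n r : nat) (T : tableau) (i : nat) : nat :=
  nth 0 (blocks n r T) i.*2.-1.

Definition blk_len (n r : nat) (T : tableau) : nat :=
  (size (blocks n r T))./2.-1.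

(* f_k^(r)(T), for T with n cells; the column index is 0-based. *)
Definition hikita_f (n r k : nat) (T : tableau) : tableau :=
  add_bottom T
    (\sum_(1 <= i < k.+1) blk_a n r T i + \sum_(0 <= i < k.+1) blk_b n r T i)
    n.+1.

Local Open Scope ring_scope.

Definition qint (R : pzRingType) (q : R) (m : nat) : R := \sum_(i < m) q ^+ i.

Definition qfact (R : pzRingType) (q : R) (m : nat) : R :=
  \prod_(1 <= i < m.+1) qint q i.

Definition qfact_part (R : pzRingType) (q : R) (lam : seq nat) : R :=
  \prod_(k <- lam) qfact q k.

(* Quotients of products of q-integers, which can be evaluated in any field:  *)
(* at the indeterminate of Q(q), or at a real number tau >= 0, where the      *)
(* denominator does not vanish.                                               *)
Record qquot := QQuot {
  qnum : seq nat;
  qden : seq nat;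
  qnum_gt0 : all (leq 1%N) qnum;
  qden_gt0 : all (leq 1%N) qden }.

Definition qquot_eval (F : fieldType) (h : qquot) (q : F) : F :=
  (\prod_(k <- qnum h) qint q k) / (\prod_(k <- qden h) qint q k).

(* Q(q), as the field of fractions of Z[q]. *)
Notation Qq := {fraction {poly int}}.

Definition qvar : Qq := tofrac 'X.

Definition hikita_phi (n r k : nat) (T : tableau) : Qq :=
  let a := blk_a n r T in
  let b := blk_b n r T in
  let l := blk_len n r T in
  let br := qint qvar in
  qvar ^+ (\sum_(1 <= i < k.+1) a i)
  * \prod_(1 <= i < k.+1)
      (br (\sum_(i.+1 <= j < k.+1) a j + \sum_(i <= j < k.+1) b j)%N
       / br (\sum_(i <= j < k.+1) a j + \sum_(i <= j < k.+1) b j)%N)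
  * \prod_(k.+1 <= i < l.+1)
      (br (\sum_(k.+1 <= j < i.+1) a j + \sum_(k.+1 <= j < i) b j)%N
       / br (\sum_(k.+1 <= j < i.+1) a j + \sum_(k.+1 <= j < i.+1) b j)%N).

(* For T standard with n cells.  The only S for which T = f_k(S) is possible  *)
(* is T with its entry n erased, and k is then determined by the column of n. *)
Fixpoint hikita_prob (m : nat -> nat) (n : nat) (T : tableau) : Qq :=
  if n is n'.+1 then
    let S := erase T n in
    if [pick k : 'I_(blk_len n' (m n) S).+1 | hikita_f n' (m n) k S == T]
      is Some k
    then hikita_phi n' (m n) k S * hikita_prob m n' S
    else 0
  else 1.

Definition HikSYT (n : nat) (m : nat -> nat) (lam : seq nat) : set tableau :=
  [set T | [/\ standard n T, shape T = lam & hikita_prob m n T != 0]]%classic.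

Definition proper (n N : nat) (G : rel 'I_n) (kappa : {ffun 'I_n -> 'I_N}) :=
  [forall i, forall j, G i j ==> (kappa i != kappa j)].

Definition coloring_inv (n N : nat) (G : rel 'I_n)
    (kappa : {ffun 'I_n -> 'I_N}) : nat :=
  #|[set ij : 'I_n * 'I_n |
      [&& (ij.1 < ij.2)%N, G ij.1 ij.2 & (kappa ij.2 < kappa ij.1)%N]]|.

(* The image X_G(x_1, ..., x_N, q) of X_G under x_i = 0 for i > N. *)
Definition chromatic (n : nat) (G : rel 'I_n) (N : nat)
    : {mpoly {poly int}[N]} :=
  \sum_(kappa : {ffun 'I_n -> 'I_N} | proper G kappa)
    'X^(coloring_inv G kappa) *: \prod_(i < n) 'X_(kappa i).

Definition elem_sym (N : nat) (lam : seq nat) : {mpoly {poly int}[N]} :=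
  \prod_(k <- lam) mesym N {poly int} k.

(* A symmetric function of degree n over Z[q] is given by the compatible      *)
(* family of its images in N variables, for all N.                            *)
Definition e_expansion (n : nat) (X : forall N, {mpoly {poly int}[N]})
    (c : seq nat -> {poly int}) : Prop :=
  forall N, X N =
    \sum_(lam \in [set lam | is_partition n lam]%classic)
      c lam *: elem_sym N lam.

(* The coefficient of e_lam, for lam a partition of n: the coefficients of an *)
(* e-expansion are unique, as the e_lam are linearly independent for N >= n.  *)
Definition e_coef (n : nat) (X : forall N, {mpoly {poly int}[N]})
    (lam : seq nat) : {poly int} :=
  xget (fun=> 0) [set c | e_expansion n X c]%classic lam.

Definition chromatic_coef (n : nat) (P : rel 'I_n) (lam : seq nat)
    : {poly int} :=
  e_coef n (chromatic (inc P)) lam.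

(* Main.v *)
Require Import Defs.
From HB Require Import structures.
From mathcomp Require Import all_boot all_order all_algebra.
From mathcomp Require Import mpoly.
From mathcomp Require Import boolp classical_sets fsbigop reals.
From mathcomp Require Import perm zify ring lra.
Import Defs.
Set Implicit Arguments.
Unset Strict Implicit.
Unset Printing Implicit Defensive.
Import Order.TTheory GRing.Theory Num.Theory.
Local Open Scope ring_scope.

(** Number the vertices from 0 and let mu k = m (k+1).  Both sides of the theorem
    are sums, over all maps kap from the vertices to a finite set, of the
    products over k of a weight that depends on kap k and on the values of kap
    at the smaller neighbours i of k, those with mu k <= i < k.

    For the chromatic function, kap is a colouring and the weight of the colour
    c is x_c q^#{p > c}, where p runs over the colours of the neighbours, or 0
    if one of these is c ([chromatic_Zsum]).  For the tableaux, kap k is the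
    column of the entry k+1, and the weight of a column is its transition
    probability at q^-1 times [c+1] e_(c+1) / e_c ([column_weight],
    [column_ratio]).  The last factors multiply to [lam]! e_lam over the cells
    of a tableau of shape lam.  The probability at q^-1, a product over the
    columns that contain an entry incomparable to the new one, is q to the number
    of such columns to the right of the new box, times a quotient of products of
    q-integers: multiplied over all entries, this is q^inv(T) h_T(q)
    ([column_weight_step]).  A telescoping product shows that each quotient is at
    most 1 at tau >= 0 ([step_eval_bound]).

    The two sums agree because both satisfy the modular law of Abreu and Nigro
    ([modular_law]), two linear relations between shapes mu that differ in one
    or two rows.  Each of these reduces to an identity between weights by adding
    the contributions of kap and of kap with two twin vertices exchanged
    ([Zsum_modular_left], [Zsum_modular_right]).  For colours, the identity
    compares three colours ([color_weight_modular]); for columns, it is one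
    between rational functions of the powers of q ([column_weight_modular]).
    Moreover, the modular law determines a function by its values on disjoint
    unions of cliques ([modular_eq0]): inside a block of twin rows and twin
    vertices it allows every path to be replaced by paths that cut the block at
    its border ([modular_words_eq0]).  On a clique with a vertices both sums are
    [a]! e_a, and both are multiplicative over disjoint unions
    ([color_clique], [column_clique], [Zsum_disjoint]).

    This gives the expansion over a field of fractions ([phi_chromatic]).  After
    multiplication by a common denominator it holds between polynomials, and the
    fundamental theorem on symmetric polynomials shows that its coefficients are
    divisible by this denominator and are those of the e-expansion
    ([chromatic_coefE]). *)

(** * Relations between lattice paths *)

Section QInt.
Variables (K : fieldType) (q : K).

Lemma qint0 : qint q 0 = 0.
Proof. exact: big_ord0. Qed.

Lemma qintS k : qint q k.+1 = qint q k + q ^+ k.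
Proof. exact: big_ord_recr. Qed.

Lemma qintSl k : qint q k.+1 = 1 + q * qint q k.
Proof.
rewrite /qint big_ord_recl expr0 big_distrr /=.
by congr (_ + _); apply: eq_bigr => i _; rewrite -exprS.
Qed.

Lemma qint1 : qint q 1 = 1.
Proof. by rewrite qintS qint0 add0r. Qed.

Hypothesis qint_neq0 : forall k, qint q k.+1 != 0.
Hypothesis q_neq0 : q != 0.

(** The differences of consecutive values form a geometric progression of ratio
    1/q, hence q^(s-1) a_s = [s] a_1: the end values determine all others. *)
Lemma modular_interpolation (a : nat -> K) s :
    (forall k, (k.+2 <= s)%N -> (1 + q) * a k.+1 = q * a k.+2 + a k) ->
  a 0%N = 0 -> a s = 0 -> forall k, (k <= s)%N -> a k = 0.
Proof.
move=> rec a0 as0.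
have closed k : (k.+1 <= s)%N ->
    q ^+ k * a k.+1 = qint q k.+1 * a 1%N /\
    q ^+ k * a k = q * qint q k * a 1%N.
  elim: k => [|k IHk] ks; first by rewrite a0 qint0 qint1; split; ring.
  have [e1 e0] := IHk (ltnW ks).
  split; last by rewrite exprS -mulrA e1 mulrA.
  have -> : q ^+ k.+1 * a k.+2 = q ^+ k * ((1 + q) * a k.+1 - a k).
    by rewrite (rec k ks) exprS; ring.
  rewrite mulrBr mulrCA e1 e0 [qint q k.+2]qintSl !qintSl; ring.
case: s as0 rec closed => [_ _ _ k|s as0 rec closed].
  by rewrite leqn0 => /eqP->.
have a10 : a 1%N = 0.
  have [e _] := closed s (leqnn _); move: e; rewrite as0 mulr0 => /esym/eqP.
  by rewrite mulf_eq0 (negPf (qint_neq0 _)) /= => /eqP.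
case=> [//|k] ks; have [e _] := closed k ks; move: e.
by rewrite a10 mulr0 => /eqP; rewrite mulf_eq0 expf_eq0 (negPf q_neq0) andbF /= => /eqP.
Qed.

(** A word is a lattice path, with true for an up-step U and false for a
    down-step D.  The counts restrict the relations
    (1+q) DUD = q DDU + UDD and (1+q) UDU = q DUU + UUD, read inside a word, to
    the words with s down-steps and b up-steps. *)
Definition modular_words (s b : nat) (d : seq bool -> K) :=
  (forall w1 w2,
     (count negb w1 + count negb w2).+2 = s ->
     (count id w1 + count id w2).+1 = b ->
   (1 + q) * d (w1 ++ [:: false; true; false] ++ w2) =
     q * d (w1 ++ [:: false; false; true] ++ w2) +
     d (w1 ++ [:: true; false; false] ++ w2)) /\
  (forall w1 w2,
     (count negb w1 + count negb w2).+1 = s ->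
     (count id w1 + count id w2).+2 = b ->
   (1 + q) * d (w1 ++ [:: true; false; true] ++ w2) =
     q * d (w1 ++ [:: false; true; true] ++ w2) +
     d (w1 ++ [:: true; true; false] ++ w2)).

Lemma count_negb_nseq k x : count negb (nseq k x) = (~~ x * k)%N.
Proof. by rewrite count_nseq. Qed.

Lemma count_id_nseq k (x : bool) : count id (nseq k x) = (x * k)%N.
Proof. by rewrite count_nseq. Qed.

Lemma nseqS_rcons T k (x : T) : nseq k.+1 x = rcons (nseq k x) x.
Proof. by rewrite -addn1 nseqD cats1. Qed.

Lemma size_ups_downs (w : seq bool) : size w = (count negb w + count id w)%N.
Proof. by rewrite -(count_predC negb); congr addn; apply: eq_count => -[]. Qed.

(** The corners U^j D^s U^(b-j) span all words modulo the relations.  A word that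
    begins or ends with U is handled by induction on the rest of it.  For the
    others, induction on the interior leaves only D U^j D^(s-2) U^(b-j) D; if
    two U are adjacent to an outer D, the second relation turns this D into a
    step further inside, and otherwise a single U is moved to an end through
    the D's by interpolation. *)
Lemma modular_words_eq0 s b (d : seq bool -> K) :
    modular_words s b d ->
    (forall j, (j <= b)%N ->
       d (nseq j true ++ nseq s false ++ nseq (b - j) true) = 0) ->
  forall w, count negb w = s -> count id w = b -> d w = 0.
Proof.
move=> hd corner w; have [N sz] := ubnP (size w).
elim: N => // N IHN in s b d w hd corner sz *.
have starts_up : forall v, (size v < N)%N -> count negb v = s ->
    (count id v).+1 = b -> d (true :: v) = 0.
  move=> v szv vs vb; case: b vb hd corner => // b [vb] [hA hB] corner.
  apply: (IHN s b (fun v => d (true :: v)) v) => //.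
    split=> w1 w2 c1 c2.
      by have := hA (true :: w1) w2; apply=> //=; rewrite ?add0n -?c2.
    by have := hB (true :: w1) w2; apply=> //=; rewrite ?add0n -?c2.
  by move=> j jb; have := corner j.+1 jb.
have ends_up : forall v, (size v < N)%N -> count negb v = s ->
    (count id v).+1 = b -> d (rcons v true) = 0.
  move=> v szv vs vb; case: b vb hd corner {starts_up} => // b [vb] [hA hB] corner.
  apply: (IHN s b (fun v => d (rcons v true)) v) => //.
    split=> w1 w2 c1 c2; rewrite !rcons_cat /=.
      by have := hA w1 (rcons w2 true); rewrite -!cats1 !count_cat /=; apply; lia.
    by have := hB w1 (rcons w2 true); rewrite -!cats1 !count_cat /=; apply; lia.
  move=> j jb; have := corner j (leqW jb).
  by rewrite subSn // !rcons_cat -nseqS_rcons.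
case: w sz => [|[] w] sz; first by move=> sb bb; have := corner 0%N; rewrite -sb -bb /=; apply.
  by move=> sw bw; apply: starts_up; rewrite ?ltnS -?sw -?bw.
case/lastP: w sz => [|w []] sz.
- by move=> sb bb; have := corner 0%N; rewrite -sb -bb /=; apply.
- move=> sw bw; rewrite -rcons_cons; apply: ends_up.
  + by move: sz; rewrite /= size_rcons.
  + by move: sw; rewrite -cats1 /= count_cat /=; lia.
  + by move: bw; rewrite -cats1 /= count_cat /=; lia.
rewrite -cats1 /= !count_cat /= !addn0 !addn1 !add0n.
case: s hd corner starts_up ends_up => [|[|s]] // hd corner starts_up ends_up.
case=> sw bw.
have szw : (size w < N)%N by move: sz; rewrite /= size_rcons; lia.
have szwE : (size w = s + b)%N.
  by rewrite size_ups_downs sw bw.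
have {}starts_up v : (size v).+1 = (s.+2 + b)%N -> count negb v = s.+2 ->
    (count id v).+1 = b -> d (true :: v) = 0.
  by move=> sv; apply: starts_up; move: sz; rewrite /= size_rcons; lia.
have {}ends_up v : (size v).+1 = (s.+2 + b)%N -> count negb v = s.+2 ->
    (count id v).+1 = b -> d (v ++ [:: true]) = 0.
  by rewrite cats1 => sv; apply: ends_up; move: sz; rewrite /= size_rcons; lia.
apply: (IHN s b (fun v => d (false :: (v ++ [:: false]))) w) => //.
  case: hd => hA hB; split=> w1 w2 c1 c2; rewrite -!catA.
    have := hA (false :: w1) (w2 ++ [:: false]).
    by rewrite /= !count_cat /=; apply; lia.
  have := hB (false :: w1) (w2 ++ [:: false]).
  by rewrite /= !count_cat /=; apply; lia.
move=> j jb; case: hd => hA hB.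
have count_n := (count_cat, count_negb_nseq, count_id_nseq, size_cat, size_nseq).
case: (ltnP 1 j) => [j1|].
  (* two up-steps after the initial down-step *)
  case: j j1 jb => [|[|j]] // _ jb.
  have := hB [::] (nseq j true ++ nseq s false ++ nseq (b - j.+2) true ++ [:: false]).
  rewrite /= !starts_up ?count_n /= ?count_n /=; try lia.
  rewrite !mulr0 addr0 => /(_ _ _)/esym/eqP; rewrite mulf_eq0 (negPf q_neq0) /=.
  rewrite -!catA => h; apply/eqP/h; lia.
case: (ltnP 1 (b - j)) => [j1 _|].
  (* two up-steps before the final down-step *)
  case e: (b - j)%N j1 => [|[|k]] // _.
  have := hB (false :: nseq j true ++ nseq s false ++ nseq k true) [::].
  rewrite !cats0.
  have -> : (false :: nseq j true ++ nseq s false ++ nseq k true) ++ [:: true; true; false] =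
      false :: ((nseq j true ++ nseq s false ++ nseq k.+2 true) ++ [:: false]).
    by rewrite -[k.+2]addn2 nseqD -!catA /= -!catA.
  have endE v x y : v ++ [:: x; y; true] = (v ++ [:: x; y]) ++ [:: true].
    by rewrite -catA.
  rewrite !endE !ends_up ?count_n /= ?count_n /=; try lia.
  by rewrite !mulr0 add0r => -> //; rewrite ?count_n /=; lia.
move=> bj j1.
(* at most two up-steps remain: move the first one through the down-steps *)
have single t z : (t + count negb z = s.+2)%N -> (1 + count id z = b)%N ->
    d (nseq t false ++ true :: z) = 0 ->
  forall k, (k <= t)%N -> d (nseq k false ++ true :: nseq (t - k) false ++ z) = 0.
  move=> tz bz last0.
  apply: modular_interpolation => [k kt||]; last by rewrite subnn.
    set u := (t - k.+2)%N.
    have [-> ->] : (t - k = u.+2)%N /\ (t - k.+1 = u.+1)%N by lia.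
    have := hA (nseq k false) (nseq u false ++ z).
    rewrite -[k.+2]addn2 -[k.+1]addn1 !nseqD -!catA /= => -> //.
      by rewrite !count_n /=; lia.
    by rewrite !count_n /=; lia.
  by rewrite starts_up // ?count_n /= ?count_n /=; have := size_ups_downs z; lia.
case: j jb bj j1 => [|[|//]] jb; rewrite ?subn0 ?subn1 /=.
  case: b corner starts_up ends_up hA hB single {sw bw szwE IHN jb} =>
    [|[|//]] corner starts_up ends_up hA hB single _ _ /=.
    have := corner 0%N isT; rewrite /= !cats0.
    by rewrite -[[:: false]]/(nseq 1 false) -nseqD addn1.
  have := single s.+2 [::] _ _ _ s.+1 (leqnSn _).
  rewrite subSnn /= ?cats0 -catA; apply => //; rewrite ?addn0 //.
  by rewrite (ends_up (nseq s.+2 false)) ?count_n ?size_nseq //; lia.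
case b1: b.-1 => [|[|//]] _ _ /=.
  have := single s.+2 [::] _ _ _ 1%N isT.
  rewrite /= !cats0 -[[:: false]]/(nseq 1 false) -nseqD addn1.
  apply; rewrite /= ?addn0 //; try lia.
  by rewrite (ends_up (nseq s.+2 false)) ?count_n ?size_nseq //; lia.
have := single s.+1 [:: true; false] _ _ _ 1%N isT.
rewrite /= subn1 -catA; apply => //; rewrite ?addn1 //; try lia.
have := hB (nseq s.+1 false) [::].
have endE x y :
    nseq s.+1 false ++ [:: x; y; true] = (nseq s.+1 false ++ [:: x; y]) ++ [:: true].
  by rewrite -catA.
rewrite !cats0 !endE !ends_up ?count_n /= ?size_nseq //; try lia.
by rewrite !mulr0 add0r => -> //; lia.
Qed.
End QInt.

(** * The modular law determines a function from its values on unions of cliques *)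

(** Vertices are numbered from 0, and mu k = m (k+1): the vertex k is adjacent
    to exactly those i < k with mu k <= i. *)
Definition hess (n : nat) (mu : nat -> nat) : Prop :=
  (forall k, (k < n)%N -> (mu k <= k)%N) /\
  (forall k, (k.+1 < n)%N -> (mu k <= mu k.+1)%N).

Lemma hess_le n mu i j :
  hess n mu -> (i <= j)%N -> (j < n)%N -> (mu i <= mu j)%N.
Proof.
move=> [_ h]; elim: j => [|j IHj]; first by rewrite leqn0 => /eqP->.
rewrite leq_eqVlt => /orP[/eqP->//|ij] jn.
by apply: leq_trans (IHj ij (ltnW jn)) (h _ jn).
Qed.

Definition set_row (mu : nat -> nat) (j v : nat) : nat -> nat :=
  fun k => if k == j then v else mu k.

(** The modular law of Abreu and Nigro.  In the first relation u and u+1 are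
    twins, apart from j: the row j of mu separates them, or contains both, or
    none.  In the second one j and j+1 are twins, apart from r. *)
Definition modular_law (K : fieldType) (q : K) (n : nat) (d : (nat -> nat) -> K) :
    Prop :=
  [/\ forall mu1 mu2, (forall k, (k < n)%N -> mu1 k = mu2 k) -> d mu1 = d mu2,
      forall mu u j, hess n mu -> (u.+1 < j < n)%N -> mu j = u.+1 ->
        mu u = mu u.+1 -> (forall k, (k < n)%N -> k != j -> mu k != u.+1) ->
        (1 + q) * d mu = q * d (set_row mu j u.+2) + d (set_row mu j u) &
      forall mu j r, hess n mu -> (j.+1 < n)%N -> (r < j)%N -> mu j = r ->
        mu j.+1 = r.+1 -> (forall k, (k < n)%N -> mu k != j.+1) ->
        (1 + q) * d mu = q * d (set_row mu j r.+1) + d (set_row mu j.+1 r)].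

(** Rows of mu are up-steps of a path, and the value of a row is the number of
    down-steps that precede it. *)
Fixpoint downs_before (w : seq bool) (k : nat) : nat :=
  match w with
  | [::] => 0
  | true :: w' => if k is k'.+1 then downs_before w' k' else 0
  | false :: w' => (downs_before w' k).+1
  end.

Lemma downs_before_cat w1 w2 k :
  downs_before (w1 ++ w2) k =
    if (k < count id w1)%N then downs_before w1 k
    else (count negb w1 + downs_before w2 (k - count id w1))%N.
Proof.
elim: w1 k => [|[] w1 IHw1] k /=; first by rewrite subn0.
  by case: k => [|k] //=; rewrite IHw1 add1n ltnS subSS add0n.
by rewrite IHw1 add0n; case: ifP; rewrite ?add1n ?addSn.
Qed.

Lemma downs_before_le w k : (downs_before w k <= count negb w)%N.
Proof.
by elim: w k => [|[] w IHw] [|k] //=; rewrite ?add1n ?ltnS // IHw.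
Qed.

Lemma downs_before_mono w k : (downs_before w k <= downs_before w k.+1)%N.
Proof. by elim: w k => [|[] w IHw] [|k] //=; rewrite ltnS. Qed.

Lemma downs_before_nseq b (x : bool) k :
  downs_before (nseq b x) k = (~~ x * b)%N.
Proof. by case: x; elim: b k => [|b IHb] [|k] //=; rewrite IHb ?mul1n. Qed.

Section ThreeSteps.
Variables w1 w2 : seq bool.
Let u := count id w1.
Let d := count negb w1.

Lemma downs_before_DUD : downs_before (w1 ++ [:: false; true; false] ++ w2) u = d.+1.
Proof. by rewrite downs_before_cat ltnn subnn /= addn1. Qed.

Lemma downs_before_DUD_neq k :
  k != u -> downs_before (w1 ++ [:: false; true; false] ++ w2) k != d.+1.
Proof.
move=> ku; rewrite downs_before_cat -/u -/d; case: ltnP => uk.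
  by have := downs_before_le w1 k; rewrite -/d; lia.
by case e: (k - u)%N => [|i] /=; lia.
Qed.

Lemma downs_before_DDU k :
  downs_before (w1 ++ [:: false; false; true] ++ w2) k =
    if k == u then d.+2 else downs_before (w1 ++ [:: false; true; false] ++ w2) k.
Proof.
rewrite !downs_before_cat -/u -/d; case: ltngtP => [//|uk|->].
  by case e: (k - u)%N => [|i] //=; lia.
by rewrite subnn /= addn2.
Qed.

Lemma downs_before_UDD k :
  downs_before (w1 ++ [:: true; false; false] ++ w2) k =
    if k == u then d else downs_before (w1 ++ [:: false; true; false] ++ w2) k.
Proof.
rewrite !downs_before_cat -/u -/d; case: ltngtP => [//|uk|->].
  by case e: (k - u)%N => [|i] //=; lia.
by rewrite subnn /= addn0.
Qed.

Lemma downs_before_UDU :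
  (downs_before (w1 ++ [:: true; false; true] ++ w2) u = d) *
  (downs_before (w1 ++ [:: true; false; true] ++ w2) u.+1 = d.+1).
Proof.
rewrite !downs_before_cat -/u -/d ltnn subnn /= addn0 ltnNge leqnSn /=.
by rewrite subSnn /= addn1.
Qed.

Lemma downs_before_DUU k :
  downs_before (w1 ++ [:: false; true; true] ++ w2) k =
    if k == u then d.+1 else downs_before (w1 ++ [:: true; false; true] ++ w2) k.
Proof.
rewrite !downs_before_cat -/u -/d; case: ltngtP => [//|uk|->].
  by case e: (k - u)%N => [|[|i]] //=; lia.
by rewrite subnn /= addn1.
Qed.

Lemma downs_before_UUD k :
  downs_before (w1 ++ [:: true; true; false] ++ w2) k =
    if k == u.+1 then d else downs_before (w1 ++ [:: true; false; true] ++ w2) k.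
Proof.
rewrite !downs_before_cat -/u -/d; case: eqP => [->|ku].
  by rewrite ltnNge leqnSn /= subSnn /= addn0.
case: ltnP => [//|uk].
by case e: (k - u)%N => [|[|i]] //=; lia.
Qed.
End ThreeSteps.

(** The shape of mu on the b rows from A on is replaced by the path w, which
    starts at the value lo. *)
Definition set_block (mu : nat -> nat) (A b lo : nat) (w : seq bool) : nat -> nat :=
  fun k => if (A <= k < A + b)%N then (lo + downs_before w (k - A))%N else mu k.

Section Block.
Variables (n : nat) (mu : nat -> nat) (A b lo s : nat).
Hypotheses (hmu : hess n mu) (Abn : (A + b <= n)%N) (los : (lo + s <= A)%N).
Hypotheses (mu_before : forall k, (k < A)%N -> (mu k <= lo)%N).
Hypotheses (mu_after : forall k, (A + b <= k < n)%N -> (lo + s <= mu k)%N).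

Lemma hess_set_block w : count negb w = s -> hess n (set_block mu A b lo w).
Proof.
move=> ws; split=> k kn; rewrite /set_block.
  have := downs_before_le w (k - A); have := hmu.1 _ kn; case: ifP; lia.
have := hmu.2 _ kn; have := @mu_after k.+1; have := @mu_before k.
have := downs_before_le w (k - A); have := downs_before_mono w (k - A).
have := downs_before_le w (k.+1 - A).
case: (boolP (A <= k < A + b)%N) => kA;
  case: (boolP (A <= k.+1 < A + b)%N) => k1A; try lia.
have -> : (k.+1 - A = (k - A).+1)%N by lia.
by lia.
Qed.

(** The down-steps of w run over vertices that are twins, apart from the rows of
    the block; the rows of the block are twins as well, because no value of mu
    falls strictly inside it.  So both relations of the modular law apply at
    every place of w. *)
Lemma modular_words_set_block (K : fieldType) (q : K) (d : (nat -> nat) -> K) :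
    (forall k, (lo < k < lo + s)%N -> mu k.-1 = mu k) ->
    (forall k, (k < n)%N -> ~~ (A < mu k < A + b)%N) ->
    modular_law q n d ->
  modular_words q s b (fun w => d (set_block mu A b lo w)).
Proof.
move=> twins no_mid [d_ext dA dB].
have rowE w w' p v : (p < b)%N -> (forall k, downs_before w' k =
       if k == p then v else downs_before w k) ->
    d (set_block mu A b lo w') = d (set_row (set_block mu A b lo w) (A + p) (lo + v)).
  move=> pb w'E; apply: d_ext => k kn; rewrite /set_row /set_block w'E.
  have -> : (k == (A + p)%N) = (A <= k)%N && ((k - A)%N == p) by lia.
  by case: (leqP A k) => //= Ak; case: eqP => // e; case: ifP => //; lia.
split=> w1 w2 c1 c2.
  set w := w1 ++ [:: false; true; false] ++ w2.
  have ws : count negb w = s by rewrite /w !count_cat /=; lia.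
  rewrite (rowE _ _ _ _ _ (downs_before_DDU w1 w2)); last lia.
  rewrite (rowE _ _ _ _ _ (downs_before_UDD w1 w2)); last lia.
  rewrite !addnS.
  have := downs_before_DUD w1 w2; rewrite -/w => wj.
  apply: dA => [||||k kn kj].
  - exact: hess_set_block.
  - lia.
  - by rewrite /set_block addKn wj; case: ifP; lia.
  - rewrite /set_block; case: ifP => [|_]; first lia; case: ifP => [|_]; first lia.
    by apply: (twins (lo + count negb w1).+1); lia.
  - rewrite /set_block; case: ifP => [kA|kA].
      by have := @downs_before_DUD_neq w1 w2 (k - A)%N; rewrite -/w; lia.
    by have := @mu_before k; have := @mu_after k; lia.
set w := w1 ++ [:: true; false; true] ++ w2.
have ws : count negb w = s by rewrite /w !count_cat /=; lia.
rewrite (rowE _ _ _ _ _ (downs_before_DUU w1 w2)); last lia.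
rewrite (rowE _ _ _ _ _ (downs_before_UUD w1 w2)); last lia.
have [w_j w_j1] := downs_before_UDU w1 w2; rewrite -/w in w_j w_j1.
rewrite !addnS; apply: dB => [|||||k kn].
- exact: hess_set_block.
- lia.
- lia.
- by rewrite /set_block addKn w_j; case: ifP; lia.
- by rewrite /set_block -addnS addKn w_j1; case: ifP; lia.
- rewrite /set_block; case: ifP => kA; last by have := no_mid k kn; lia.
  by have := downs_before_le w (k - A); lia.
Qed.
End Block.

(** A value r of mu at which mu does not jump.  Cutting the path at the values
    of mu, this says that the cut at r falls inside a run of equal rows. *)
Definition unaligned (n : nat) (mu : nat -> nat) (r : nat) : bool :=
  [&& (0 < r < n)%N, mu r.-1 == mu r & has (fun k => mu k == r) (iota 0 n)].

(** Orders sets of numbers by their smallest difference. *)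
Fixpoint binary_code (B : nat -> bool) (k : nat) : nat :=
  if k is k'.+1 then (binary_code B k').*2 + B k' else 0.

Lemma binary_code_lt (B B' : nat -> bool) r n :
    (r < n)%N -> B r -> ~~ B' r -> (forall i, (i < r)%N -> B' i -> B i) ->
  (binary_code B' n < binary_code B n)%N.
Proof.
move=> rn Br B'r sub.
have le k : (k <= r)%N -> (binary_code B' k <= binary_code B k)%N.
  elim: k => //= k IHk kr; have := IHk (ltnW kr); have := sub k kr.
  by case: (B' k) => [->//|_]; lia.
elim: n rn => // n IHn; rewrite ltnS leq_eqVlt => /orP[/eqP<-|rn] /=.
  by have := le r (leqnn r); rewrite Br (negPf B'r); lia.
by have := IHn rn; lia.
Qed.

Section Uniqueness.
Variables (K : fieldType) (q : K) (n : nat) (d : (nat -> nat) -> K).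
Hypothesis qint_neq0 : forall k, qint q k.+1 != 0.
Hypothesis q_neq0 : q != 0.
Hypothesis law : modular_law q n d.
Hypothesis d_cliques : forall mu,
  hess n mu -> (forall r, ~~ unaligned n mu r) -> d mu = 0.

(** Take the largest unaligned value r.  The rows of value r are twins, since a
    value of mu strictly between them would be unaligned and larger than r.
    Take s as large as possible with lo + s = r+1 such that the vertices from
    lo to r are twins and no row before the block exceeds lo.  By
    [modular_words_eq0], the shape mu may be replaced by shapes whose block
    takes only the values lo and r+1.  The value r then disappears, and lo is
    unaligned only if it was so before: the set of unaligned values decreases
    at its smallest difference. *)
Lemma modular_eq0 mu : hess n mu -> d mu = 0.
Proof.
have [d_ext _ _] := law.
have [N] := ubnP (binary_code (unaligned n mu) n); elim: N mu => // N IHN mu code hmu.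
case: (boolP (has (unaligned n mu) (iota 0 n))) => [/hasP[r0 r0n unal_r0]|/hasPn aligned].
  2: apply: d_cliques => // r; case: (boolP (unaligned n mu r)) => // unal_r.
  2: have rn : r \in iota 0 n by rewrite mem_iota; case/and3P: unal_r; lia.
  2: by have := aligned r rn; rewrite unal_r.
have ex_r : exists r, unaligned n mu r by exists r0.
have unal_le r : unaligned n mu r -> (r <= n)%N by case/and3P; lia.
case: (ex_maxnP ex_r unal_le) => r unal_r r_max {ex_r unal_le r0n unal_r0 r0}.
have /and3P[r_n /eqP twin_r /hasP[k0]] := unal_r.
rewrite mem_iota add0n => /= k0n /eqP muk0.
have mono := @hess_le n mu.
(* the rows of value r are those from A to E - 1 *)
have exA : exists k, (r <= mu k)%N && (k < n)%N by exists k0; rewrite muk0 leqnn.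
case: (ex_minnP exA) => A /andP[rA An] A_min.
have muA : mu A = r.
  apply/eqP; rewrite eqn_leq rA andbT -muk0 mono //.
  by apply: A_min; rewrite muk0 leqnn.
have before k : (k < A)%N -> (mu k < r)%N.
  by move=> kA; have := A_min k; have := @ltn_trans A k n; lia.
have exE : exists k, (r < mu k)%N || (n <= k)%N by exists n; rewrite leqnn orbT.
case: (ex_minnP exE) => E E_end E_min.
have block k : (A <= k < E)%N -> mu k = r.
  move=> /andP[Ak kE]; have [kn|kn] := ltnP k n; last by have := E_min k; lia.
  have := mono A k hmu Ak kn; have := E_min k; rewrite muA; lia.
have En : (E <= n)%N by apply: E_min; rewrite leqnn orbT.
have AE : (A < E)%N.
  rewrite ltnNge; apply/negP => EA; case/orP: E_end; last lia.
  by move=> rE; have := mono E A hmu EA An; lia.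
have after k : (E <= k < n)%N -> (r < mu k)%N.
  move=> /andP[Ek kn]; case/orP: E_end => [rE|]; last lia.
  exact: leq_trans rE (mono E k hmu Ek kn).
have rA' : (r < A)%N.
  rewrite ltnNge; apply/negP => Ar; have := mono A r.-1 hmu; have := hmu.1 A An.
  have := hmu.1 r.-1; have := mono A r hmu Ar; lia.
(* by minimality, lo is the value of the row A - 1 or the start of a run of twins *)
have exlo : exists l, [&& (mu A.-1 <= l)%N, (l < r)%N &
    all (fun i => mu i.-1 == mu i) (iota l.+1 (r - l.+1))].
  have r_gt0 : (0 < r)%N by lia.
  by exists r.-1; have := before A.-1; rewrite (prednK r_gt0) subnn /=; lia.
case: (ex_minnP exlo) => lo /and3P[lo_mu lo_r /allP lo_twin] lo_min.
have twins k : (lo < k < r.+1)%N -> mu k.-1 = mu k.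
  move=> kb; case: (ltngtP k r) kb => [kr kb|//|->//]; last lia.
  by apply/eqP/lo_twin; rewrite mem_iota; lia.
have An' : (A.-1 < A)%N by lia.
set s := (r.+1 - lo)%N; set b := (E - A)%N.
have e_s : (lo + s = r.+1)%N by rewrite /s; lia.
have e_b : (A + b = E)%N by rewrite /b; lia.
have mu_before k : (k < A)%N -> (mu k <= lo)%N.
  by move=> kA; apply: leq_trans lo_mu; apply: mono => //; lia.
have mu_after k : (A + b <= k < n)%N -> (lo + s <= mu k)%N.
  by rewrite e_b e_s => /after.
have Abn : (A + b <= n)%N by rewrite e_b.
have los : (lo + s <= A)%N by rewrite e_s.
have words : modular_words q s b (fun w => d (set_block mu A b lo w)).
  apply: (@modular_words_set_block n) => //; first by rewrite e_s.
  move=> k kn; rewrite e_b; apply/negP => mid.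
  have : unaligned n mu (mu k).
    apply/and3P; split; first lia.
      have := block (mu k); have := block (mu k).-1; lia.
    by apply/hasP; exists k; rewrite ?mem_iota.
  by move=> unal_k; have := r_max _ unal_k; lia.
have -> : d mu = d (set_block mu A b lo (nseq (r - lo) false ++ nseq b true ++ [:: false])).
  apply: d_ext => k kn; rewrite /set_block e_b; case: ifP => // kAE.
  rewrite block // !downs_before_cat !count_id_nseq !count_negb_nseq mul0n mul1n ltn0.
  rewrite !mul1n downs_before_nseq ifT; lia.
apply: (modular_words_eq0 qint_neq0 q_neq0 words).
- move=> j jb.
  set w := nseq j true ++ _ ++ _.
  have ws : count negb w = s.
    by rewrite !count_cat !count_negb_nseq /=; lia.
  have wE t : downs_before w t = if (t < j)%N then 0%N else s.
    rewrite !downs_before_cat !count_id_nseq !count_negb_nseq !downs_before_nseq.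
    by rewrite !mul1n !mul0n ltn0 addn0 add0n.
  apply: IHN; last exact: (hess_set_block hmu Abn los mu_before mu_after ws).
  move: code; rewrite ltnS; apply: leq_trans; apply: (@binary_code_lt _ _ r); first lia.
  - exact: unal_r.
  - apply/negP => /and3P[_ _ /hasP[k]]; rewrite mem_iota /set_block wE => kn.
    have := after k; have := before k; rewrite e_b.
    by case: (boolP (A <= k < E)%N) => [_|kAE]; [case: ifP|]; lia.
  - move=> i ir /and3P[i0 twin /hasP[k]]; rewrite mem_iota => /= kn.
    have {}twin : mu i.-1 == mu i.
      by move: twin; rewrite /set_block !ifF //; lia.
    rewrite /set_block wE; case: ifP => kAE ki.
      have ilo : i = lo by move: ki; case: ifP; lia.
      have lo_minE : mu A.-1 = lo.
        apply/eqP; rewrite eqn_leq lo_mu /= leqNgt; apply/negP => mu_lo.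
        have := lo_min lo.-1; rewrite prednK; last lia.
        have -> : (r - lo = (r - lo.+1).+1)%N by lia.
        rewrite /= -ilo twin ilo; have /allP -> := lo_twin; lia.
      apply/and3P; split => //; apply/hasP; exists A.-1.
        by rewrite mem_iota; lia.
      by rewrite lo_minE ilo.
    by apply/and3P; split => //; apply/hasP; exists k; rewrite ?mem_iota.
- by rewrite !count_cat !count_negb_nseq /= /s; lia.
- by rewrite !count_cat !count_id_nseq /=; lia.
Qed.
End Uniqueness.

(** * Sums of local weights over maps from the vertices *)

Definition window (n : nat) (mu : nat -> nat) (k : 'I_n) : seq 'I_n :=
  [seq i : 'I_n <- enum 'I_n | (mu k <= i < k)%N].

Lemma mem_window n mu (k i : 'I_n) : (i \in window mu k) = (mu k <= i < k)%N.
Proof. by rewrite mem_filter mem_enum andbT. Qed.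

Lemma window_uniq n mu (k : 'I_n) : uniq (window mu k).
Proof. by rewrite filter_uniq ?enum_uniq. Qed.

(** Both sides of the theorem have this form: a vertex has a weight that depends
    on its own value and on the values of its smaller neighbours. *)
Definition Zsum (K : pzRingType) (C : finType) (wt : seq C -> C -> K)
    (n : nat) (mu : nat -> nat) : K :=
  \sum_(kap : {ffun 'I_n -> C}) \prod_k wt (map kap (window mu k)) (kap k).

Lemma eq_Zsum (K : pzRingType) (C : finType) (wt : seq C -> C -> K) n mu1 mu2 :
  (forall k, (k < n)%N -> mu1 k = mu2 k) -> Zsum wt n mu1 = Zsum wt n mu2.
Proof.
move=> mu12; apply: eq_bigr => kap _; apply: eq_bigr => k _.
by congr (wt (map _ _) _); apply: eq_filter => i; rewrite mu12.
Qed.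

Definition swap_at (C : finType) n (u v : 'I_n) (kap : {ffun 'I_n -> C}) :
  {ffun 'I_n -> C} := [ffun i => kap (tperm u v i)].

Lemma swap_atK (C : finType) n (u v : 'I_n) : involutive (@swap_at C n u v).
Proof. by move=> kap; apply/ffunP => i; rewrite !ffunE tpermK. Qed.

Lemma perm_map_tperm (T : finType) (u v : T) (s : seq T) :
  uniq s -> (u \in s) = (v \in s) -> perm_eq (map (tperm u v) s) s.
Proof.
move=> us uv; apply: uniq_perm => // [|y].
  by rewrite map_inj_uniq //; apply: perm_inj.
rewrite -{1}(tpermK u v y) mem_map; last exact: perm_inj.
by case: tpermP => [->|->|].
Qed.

(** The last two conditions are what the modular law of [Zsum] amounts to when
    the values off the twins are fixed, and the values of the twins, p and p'
    in the first one, c and c' in the second one, are taken in both orders. *)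
Definition modular_weight (K : fieldType) (q : K) (C : finType)
    (wt : seq C -> C -> K) : Prop :=
  [/\ forall M M' c, perm_eq M M' -> wt M c = wt M' c,
      forall (M : seq C) c, c \in M -> wt M c = 0,
      forall L M p p' c, p != p' -> p \notin M -> p' \notin M ->
        wt L p * wt (p :: L) p' *
          ((1 + q) * wt (p' :: M) c - q * wt M c - wt (p :: p' :: M) c) +
        wt L p' * wt (p' :: L) p *
          ((1 + q) * wt (p :: M) c - q * wt M c - wt (p' :: p :: M) c) = 0 &
      forall L p c c', p \notin L -> c != c' ->
        (1 + q) * (wt (p :: L) c * wt (c :: L) c') - q * (wt L c * wt (c :: L) c')
          - wt (p :: L) c * wt (c :: p :: L) c' +
        ((1 + q) * (wt (p :: L) c' * wt (c' :: L) c) - q * (wt L c' * wt (c' :: L) c)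
          - wt (p :: L) c' * wt (c' :: p :: L) c) = 0].

Section Generic.
Variables (K : fieldType) (q : K) (C : finType) (wt : seq C -> C -> K).
Hypothesis two_neq0 : 2%:R != 0 :> K.
Hypothesis wt_modular : modular_weight q wt.

Let wt_perm M M' c : perm_eq M M' -> wt M c = wt M' c.
Proof. by case: wt_modular => h _ _ _; apply: h. Qed.

Let wt_mem (M : seq C) c : c \in M -> wt M c = 0.
Proof. by case: wt_modular => _ h _ _; apply: h. Qed.

(** Used with twins u and v: the contributions of kap and of kap with the twins
    exchanged cancel. *)
Lemma sum_antisymmetric n (u v : 'I_n) (F : {ffun 'I_n -> C} -> K) :
  (forall kap, F kap + F (swap_at u v kap) = 0) -> \sum_kap F kap = 0.
Proof.
move=> anti; apply/eqP.
have e : \sum_kap F kap = \sum_kap F (swap_at u v kap).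
  by rewrite (reindex_inj (can_inj (@swap_atK C n u v))).
have : (\sum_kap F kap) *+ 2 = 0.
  by rewrite mulr2n {2}e -big_split big1 //= => kap _; apply: anti.
by move/eqP; rewrite -mulr_natl mulf_eq0 (negPf two_neq0).
Qed.

Lemma wt_window n (kap : {ffun 'I_n -> C}) (mu : nat -> nat) (k : 'I_n)
    (s : seq 'I_n) :
    uniq s -> (forall i, (i \in s) = (mu k <= i < k)%N) ->
  forall c, wt (map kap (window mu k)) c = wt (map kap s) c.
Proof.
move=> us sE c; apply/wt_perm/perm_map/uniq_perm => //; first exact: window_uniq.
by move=> i; rewrite mem_window sE.
Qed.

Lemma wt_swap n (kap : {ffun 'I_n -> C}) mu (u v k : 'I_n) :
    k != u -> k != v -> (u \in window mu k) = (v \in window mu k) ->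
  wt (map (swap_at u v kap) (window mu k)) (swap_at u v kap k) =
  wt (map kap (window mu k)) (kap k).
Proof.
move=> ku kv uv; rewrite ffunE tpermD 1?eq_sym //; apply: wt_perm.
rewrite (eq_map (g := kap \o tperm u v)) => [|i]; last by rewrite ffunE.
by rewrite map_comp; apply/perm_map/perm_map_tperm; rewrite ?window_uniq.
Qed.

Lemma map_swap n (kap : {ffun 'I_n -> C}) (u v : 'I_n) s :
  u \notin s -> v \notin s -> map (swap_at u v kap) s = map kap s.
Proof.
move=> us vs; apply/eq_in_map => i si; rewrite ffunE tpermD //.
  by apply: contraNneq us => ->.
by apply: contraNneq vs => ->.
Qed.

Lemma prod_wt_eq0 n mu (kap : {ffun 'I_n -> C}) (P : pred 'I_n) (i k : 'I_n) :
    P k -> i \in window mu k -> kap i = kap k ->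
  \prod_(k | P k) wt (map kap (window mu k)) (kap k) = 0.
Proof.
move=> Pk ik e; rewrite (bigD1 k) //= [X in X * _]wt_mem ?mul0r //.
by rewrite -e map_f.
Qed.

(** Exchanging the values of the twins u and u+1 does not change the factors of
    the vertices other than u, u+1 and j.  A value of u or u+1 that recurs
    between u+1 and j makes the product vanish, since all these vertices are
    adjacent; hence the local condition applies. *)
Lemma Zsum_modular_left n mu u j :
    hess n mu -> (u.+1 < j < n)%N -> mu j = u.+1 ->
    mu u = mu u.+1 -> (forall k, (k < n)%N -> k != j -> mu k != u.+1) ->
  (1 + q) * Zsum wt n mu = q * Zsum wt n (set_row mu j u.+2) + Zsum wt n (set_row mu j u).
Proof.
move=> hmu /andP[uj jn] muj twin only_j.
have un : (u < n)%N by lia. have vn : (u.+1 < n)%N by lia.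
pose uo := Ordinal un; pose vo := Ordinal vn; pose jo := Ordinal jn.
pose f mu' kap k := wt (map (kap : {ffun 'I_n -> C}) (window mu' k)) (kap k).
pose B kap := \prod_(k | (k != jo) && (k != uo) && (k != vo)) f mu kap k.
pose D kap := (1 + q) * f mu kap jo - q * f (set_row mu j u.+2) kap jo
                - f (set_row mu j u) kap jo.
have [ju jv vu] : [/\ uo != jo, vo != jo & vo != uo].
  by rewrite -!val_eqE /=; split; lia.
have split_Z mu' : (forall k, k != j -> mu' k = mu k) -> Zsum wt n mu' =
    \sum_kap (B kap * (f mu kap uo * f mu kap vo)) * f mu' kap jo.
  move=> mu'E; apply: eq_bigr => kap _.
  rewrite (bigD1 jo) //= mulrC; congr (_ * _).
  rewrite (eq_bigr (f mu kap)) => [|k kj]; last first.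
    congr (wt (map _ _) _); apply: eq_filter => i.
    by rewrite mu'E.
  by rewrite (bigD1 uo) //= (bigD1 vo) /= ?jv // mulrA mulrC.
rewrite !split_Z; last first.
- by move=> k kj.
- by move=> k kj; rewrite /set_row (negPf kj).
- by move=> k kj; rewrite /set_row (negPf kj).
apply/eqP; rewrite -subr_eq0 opprD addrA !big_distrr -!sumrB /=; apply/eqP.
rewrite (eq_bigr (fun kap => B kap * (f mu kap uo * f mu kap vo * D kap))); last first.
  by move=> kap _; rewrite /D; ring.
apply: (@sum_antisymmetric _ uo vo) => kap; set kap' := swap_at uo vo kap.
have other_mu k : (k < n)%N -> k != j -> mu k != u.+1 by move=> kn; apply: only_j.
have -> : B kap' = B kap.
  apply: eq_bigr => k /andP[/andP[kj ku] kv]; apply: wt_swap => //.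
  rewrite !mem_window /=; have := other_mu k (ltn_ord k).
  by rewrite -!val_eqE /= in kj ku kv *; move=> /(_ kj); lia.
have kap'u : kap' uo = kap vo by rewrite ffunE tpermL.
have kap'v : kap' vo = kap uo by rewrite ffunE tpermR.
have kap'j : kap' jo = kap jo by rewrite ffunE tpermD.
pose W := window (set_row mu j u.+2) jo.
have WE i : (i \in W) = (u.+1 < i < j)%N by rewrite mem_window /set_row /= eqxx.
have uW : uo \notin W by rewrite WE /=; lia.
have vW : vo \notin W by rewrite WE /=; lia.
have [ul vl] : uo \notin window mu uo /\ vo \notin window mu uo.
  by rewrite !mem_window /=; split; lia.
have f_v (x : {ffun 'I_n -> C}) :
    f mu x vo = wt (x uo :: map x (window mu uo)) (x vo).
  apply: (@wt_window _ x mu vo (uo :: window mu uo)).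
    by rewrite /= ul window_uniq.
  move=> i; rewrite inE mem_window /= -twin -val_eqE /=; have := hmu.1 u un; lia.
have f_j1 (x : {ffun 'I_n -> C}) : f mu x jo = wt (x vo :: map x W) (x jo).
  apply: (@wt_window _ x mu jo (vo :: W)); first by rewrite /= vW window_uniq.
  by move=> i; rewrite inE WE /= muj -val_eqE /=; lia.
have f_j2 (x : {ffun 'I_n -> C}) :
    f (set_row mu j u) x jo = wt (x uo :: x vo :: map x W) (x jo).
  apply: (@wt_window _ x (set_row mu j u) jo [:: uo, vo & W]).
    by rewrite /= inE negb_or eq_sym vu uW vW window_uniq.
  by move=> i; rewrite !inE WE /= /set_row eqxx -!val_eqE /=; lia.
rewrite -mulrDr /D !f_v !f_j1 !f_j2 /f !kap'u !kap'v !kap'j.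
rewrite -/W !(map_swap _ ul vl) !(map_swap _ uW vW).
case: (boolP ((kap uo \in map kap W) || (kap vo \in map kap W))) => [inW|].
  rewrite [B kap](_ : _ = 0) ?mul0r //.
  have [i [k [kW iuv e]]] : exists i k, [/\ k \in W, (i == uo) || (i == vo) & kap i = kap k].
    case/orP: inW => /mapP[k kW e]; [exists uo|exists vo]; exists k;
    by rewrite eqxx ?orbT.
  apply: (@prod_wt_eq0 _ _ _ _ i k) => //.
    move: kW; rewrite WE -!val_eqE /= => /andP[uk kj].
    by rewrite (ltn_eqF kj) (gtn_eqF (ltnW uk)) (gtn_eqF uk).
  have mono := @hess_le n mu k j hmu; have := other_mu k (ltn_ord k).
  move: kW iuv; rewrite WE mem_window -!val_eqE /=; lia.
rewrite negb_or => /andP[pM p'M].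
case: (eqVneq (kap uo) (kap vo)) => [->|pp].
  by rewrite [wt (_ :: _) (kap vo)]wt_mem ?mem_head // !(mulr0, mul0r) addr0 mulr0.
by case: wt_modular => _ _ local_left _; rewrite local_left // mulr0.
Qed.

(** As in [Zsum_modular_left], with the twins j and j+1. *)
Lemma Zsum_modular_right n mu j r :
    hess n mu -> (j.+1 < n)%N -> (r < j)%N ->
    mu j = r -> mu j.+1 = r.+1 -> (forall k, (k < n)%N -> mu k != j.+1) ->
  (1 + q) * Zsum wt n mu =
    q * Zsum wt n (set_row mu j r.+1) + Zsum wt n (set_row mu j.+1 r).
Proof.
move=> hmu vn rj muj muj1 no_j1.
have un : (j < n)%N by lia. have rn : (r < n)%N by lia.
pose ro := Ordinal rn; pose uo := Ordinal un; pose vo := Ordinal vn.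
pose f mu' kap k := wt (map (kap : {ffun 'I_n -> C}) (window mu' k)) (kap k).
pose B kap := \prod_(k | (k != uo) && (k != vo)) f mu kap k.
have vu : vo != uo by rewrite -!val_eqE /=; lia.
have split_Z mu' : (forall k, k != j -> k != j.+1 -> mu' k = mu k) -> Zsum wt n mu' =
    \sum_kap B kap * (f mu' kap uo * f mu' kap vo).
  move=> mu'E; apply: eq_bigr => kap _.
  rewrite (bigD1 uo) //= (bigD1 vo) //= mulrA mulrC; congr (_ * _).
  apply: eq_bigr => k /andP[kj kj1].
  congr (wt (map _ _) _); apply: eq_filter => i.
  by rewrite mu'E.
rewrite !split_Z; last first.
- by [].
- by move=> k kj kj1; rewrite /set_row (negPf kj).
- by move=> k kj kj1; rewrite /set_row (negPf kj1).
apply/eqP; rewrite -subr_eq0 opprD addrA !big_distrr -!sumrB /=; apply/eqP.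
rewrite (eq_bigr (fun kap => B kap * ((1 + q) * (f mu kap uo * f mu kap vo)
   - q * (f (set_row mu j r.+1) kap uo * f (set_row mu j r.+1) kap vo)
   - f (set_row mu j.+1 r) kap uo * f (set_row mu j.+1 r) kap vo))); last first.
  by move=> kap _; ring.
apply: (@sum_antisymmetric _ uo vo) => kap; set kap' := swap_at uo vo kap.
have -> : B kap' = B kap.
  apply: eq_bigr => k /andP[ku kv]; apply: wt_swap => //.
  rewrite !mem_window /=; have := no_j1 k (ltn_ord k).
  by rewrite -!val_eqE /= in ku kv *; lia.
have kap'u : kap' uo = kap vo by rewrite ffunE tpermL.
have kap'v : kap' vo = kap uo by rewrite ffunE tpermR.
have kap'r : kap' ro = kap ro by rewrite ffunE tpermD // -!val_eqE /=; lia.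
pose W := window (set_row mu j r.+1) uo.
have WE i : (i \in W) = (r < i < j)%N by rewrite mem_window /set_row /= eqxx.
have uW : uo \notin W by rewrite WE /=; lia.
have vW : vo \notin W by rewrite WE /=; lia.
have rW : ro \notin W by rewrite WE /=; lia.
have ur : uo != ro by rewrite -!val_eqE /=; lia.
have W_uniq := window_uniq (set_row mu j r.+1) uo; rewrite -/W in W_uniq.
have f_u1 (x : {ffun 'I_n -> C}) : f mu x uo = wt (x ro :: map x W) (x uo).
  apply: (@wt_window _ x mu uo (ro :: W)); first by rewrite /= rW W_uniq.
  by move=> i; rewrite inE WE /= muj -val_eqE /=; lia.
have f_v1 (x : {ffun 'I_n -> C}) : f mu x vo = wt (x uo :: map x W) (x vo).
  apply: (@wt_window _ x mu vo (uo :: W)); first by rewrite /= uW W_uniq.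
  by move=> i; rewrite inE WE /= muj1 -val_eqE /=; lia.
have f_v0 (x : {ffun 'I_n -> C}) :
    f (set_row mu j r.+1) x vo = wt (x uo :: map x W) (x vo).
  apply: (@wt_window _ x _ vo (uo :: W)); first by rewrite /= uW W_uniq.
  by move=> i; rewrite inE WE /= /set_row ifF ?muj1 -?val_eqE /=; lia.
have f_u2 (x : {ffun 'I_n -> C}) :
    f (set_row mu j.+1 r) x uo = wt (x ro :: map x W) (x uo).
  apply: (@wt_window _ x _ uo (ro :: W)); first by rewrite /= rW W_uniq.
  by move=> i; rewrite inE WE /= /set_row ifF ?muj -?val_eqE /=; lia.
have f_v2 (x : {ffun 'I_n -> C}) :
    f (set_row mu j.+1 r) x vo = wt (x uo :: x ro :: map x W) (x vo).
  apply: (@wt_window _ x _ vo [:: uo, ro & W]).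
    by rewrite /= inE negb_or ur uW rW W_uniq.
  by move=> i; rewrite !inE WE /= /set_row eqxx -!val_eqE /=; lia.
rewrite -mulrDr !f_u1 !f_v1 !f_v0 !f_u2 !f_v2 /f !kap'u !kap'v !kap'r.
rewrite -/W !(map_swap _ uW vW).
case: (boolP (kap ro \in map kap W)) => [/mapP[k kW e]|rL].
  rewrite [B kap](_ : _ = 0) ?mul0r //.
  apply: (@prod_wt_eq0 _ _ _ _ ro k) => //.
    by move: kW; rewrite WE -!val_eqE /=; lia.
  have := @hess_le n mu k j hmu; rewrite muj.
  by move: kW; rewrite WE mem_window /=; lia.
case: (eqVneq (kap uo) (kap vo)) => [->|cc]; last first.
  by case: wt_modular => _ _ _ local_right; rewrite local_right // mulr0.
rewrite ![wt (kap vo :: _) (kap vo)]wt_mem ?mem_head //.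
by rewrite !mulr0 !subr0 addr0 mulr0.
Qed.
End Generic.

Lemma window_lshift r t mu (k : 'I_r) :
  perm_eq (window mu (lshift t k)) (map (@lshift r t) (window mu k)).
Proof.
apply: uniq_perm; rewrite ?window_uniq //.
  by rewrite map_inj_uniq ?window_uniq //; apply: lshift_inj.
move=> i; rewrite mem_window; case: (split_ordP i) => j ->.
  by rewrite mem_map ?mem_window //; apply: lshift_inj.
apply/idP/mapP => /= [|[x _ /eqP]]; last by rewrite eq_rlshift.
by have := ltn_ord k; lia.
Qed.

Lemma window_rshift r t mu (k : 'I_t) : mu (r + k)%N = r ->
  perm_eq (window mu (rshift r k)) (map (@rshift r t) (window (fun=> 0%N) k)).
Proof.
move=> muk; apply: uniq_perm; rewrite ?window_uniq //.
  by rewrite map_inj_uniq ?window_uniq //; apply: rshift_inj.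
move=> i; rewrite mem_window /= muk; case: (split_ordP i) => j ->.
  apply/idP/mapP => /= [|[x _ /eqP]]; last by rewrite eq_lrshift.
  by have := ltn_ord j; lia.
rewrite mem_map ?mem_window //=; last exact: rshift_inj.
by rewrite leq_addr ltn_add2l.
Qed.

Lemma Zsum_disjoint (K : fieldType) (C : finType) (wt : seq C -> C -> K)
    (wt_perm : forall M M' c, perm_eq M M' -> wt M c = wt M' c) r t mu :
    (forall k, (r <= k < r + t)%N -> mu k = r) ->
  Zsum wt (r + t) mu = Zsum wt r mu * Zsum wt t (fun=> 0%N).
Proof.
move=> mu_r.
pose glue (p : {ffun 'I_r -> C} * {ffun 'I_t -> C}) : {ffun 'I_(r + t) -> C} :=
  [ffun i => match split i with inl a => p.1 a | inr b => p.2 b end].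
pose cut (x : {ffun 'I_(r + t) -> C}) : {ffun 'I_r -> C} * {ffun 'I_t -> C} :=
  ([ffun a => x (lshift t a)], [ffun b => x (rshift r b)]).
have glueL p a : glue p (lshift t a) = p.1 a.
  by rewrite ffunE; case: splitP => [j /= /val_inj->|j /=] //; have := ltn_ord a; lia.
have glueR p b : glue p (rshift r b) = p.2 b.
  rewrite ffunE; case: splitP => [j /=|j /= /eqP]; first by have := ltn_ord j; lia.
  by rewrite eqn_add2l => /eqP/val_inj->.
rewrite /Zsum (reindex glue); last first.
  exists cut => [[x y] _|x _]; rewrite /cut.
    by congr (_, _); apply/ffunP => i; rewrite ffunE ?glueL ?glueR.
  by apply/ffunP => i; case: (split_ordP i) => j ->; rewrite ?glueL ?glueR ffunE.
rewrite big_distrlr /= pair_bigA; apply: eq_bigr => -[x y] _ /=.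
rewrite big_split_ord /=; congr (_ * _); apply: eq_bigr => k _.
  rewrite glueL (wt_perm _ _ _ (perm_map _ (window_lshift t mu k))) -map_comp.
  by congr (wt _ _); apply: eq_map => i /=; rewrite glueL.
have muk : mu (r + k)%N = r by apply: mu_r; have := ltn_ord k; lia.
rewrite glueR (wt_perm _ _ _ (perm_map _ (window_rshift muk))) -map_comp.
by congr (wt _ _); apply: eq_map => i /=; rewrite glueR.
Qed.

(** Suppose mu r < r for r = mu k, with r minimal.  Then mu r is a fixed value,
    and it is at most r-1, so that mu takes the value mu r at r-1 as well: mu
    does not jump at r. *)
Lemma aligned_fixed n mu k : hess n mu -> (forall r, ~~ unaligned n mu r) ->
  (k < n)%N -> (0 < mu k)%N -> mu (mu k) = mu k.
Proof.
move=> hmu aligned; have [N] := ubnP (mu k); elim: N k => // N IHN k kN kn r0.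
have := hmu.1 k kn => rk; apply/eqP; rewrite eqn_leq hmu.1 /=; last lia.
rewrite leqNgt; apply/negP => lt_r.
have twinless i : (i < n)%N -> (0 < mu i)%N -> mu (mu i).-1 != mu (mu i).
  move=> i_n i0; have := aligned (mu i); rewrite /unaligned; have := hmu.1 i i_n => ii.
  have -> : (0 < mu i < n)%N by lia.
  have -> : has (fun k0 => mu k0 == mu i) (iota 0 n).
    by apply/hasP; exists i; rewrite ?mem_iota.
  by rewrite andbT.
have := twinless k kn r0.
have rn : (mu k < n)%N by lia.
have le1 : (mu (mu k).-1 <= mu (mu k))%N by apply: hess_le hmu _ _; lia.
have := IHN (mu k); have le2 := @hess_le n mu (mu (mu k)) (mu k).-1 hmu.
by move: le2; lia.
Qed.

Section Comparison.
Variables (K : fieldType) (q : K) (C1 C2 : finType).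
Variables (wt1 : seq C1 -> C1 -> K) (wt2 : seq C2 -> C2 -> K).
Hypotheses (mod1 : modular_weight q wt1) (mod2 : modular_weight q wt2).
Hypothesis two_neq0 : 2%:R != 0 :> K.
Hypothesis qint_neq0 : forall k, qint q k.+1 != 0.
Hypothesis q_neq0 : q != 0.

(** If all values are aligned, then mu is constant from the last value r = mu n
    on, so that the graph is the disjoint union of its restriction to the
    vertices below r and of a clique. *)
Lemma Zsum_cliques n mu :
    (forall a, (a <= n)%N -> Zsum wt1 a (fun=> 0%N) = Zsum wt2 a (fun=> 0%N)) ->
    hess n mu -> (forall r, ~~ unaligned n mu r) ->
  Zsum wt1 n mu = Zsum wt2 n mu.
Proof.
have [N] := ubnP n; elim: N n mu => // N IHN n mu nN cliques hmu aligned.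
case: n nN cliques hmu aligned => [|n] nN cliques hmu aligned.
  by rewrite !(@eq_Zsum _ _ _ 0 mu (fun=> 0%N)) ?cliques.
case: (posnP (mu n)) => [mun|mun].
  have mu0 k : (k < n.+1)%N -> mu k = 0%N.
    by move=> kn; have := @hess_le n.+1 mu k n hmu; lia.
  by rewrite !(eq_Zsum _ mu0) cliques.
have fixed := aligned_fixed hmu aligned (ltnSn n) mun.
have mu_n := hmu.1 n (ltnSn n).
set r := mu n in fixed mun mu_n *.
have mu_r k : (r <= k < r + (n.+1 - r))%N -> mu k = r.
  move=> kb; have := @hess_le n.+1 mu r k hmu; have := @hess_le n.+1 mu k n hmu.
  by rewrite -/r fixed; lia.
have nE : (n.+1 = r + (n.+1 - r))%N by lia.
rewrite nE !Zsum_disjoint //; last 2 first.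
- by case: mod2.
- by case: mod1.
rewrite cliques; last lia; congr (_ * _); apply: IHN; try lia.
- by move=> a ar; apply: cliques; lia.
- by split=> k kr; [apply: hmu.1|apply: hmu.2]; lia.
- move=> i; apply: contra (aligned i) => /and3P[ib ti /hasP[k]].
  rewrite mem_iota => kr ki; apply/and3P; split => //; first lia.
  by apply/hasP; exists k => //; rewrite mem_iota; lia.
Qed.

Lemma Zsum_eq n mu :
    (forall a, (a <= n)%N -> Zsum wt1 a (fun=> 0%N) = Zsum wt2 a (fun=> 0%N)) ->
    hess n mu ->
  Zsum wt1 n mu = Zsum wt2 n mu.
Proof.
move=> cliques hmu; apply/eqP; rewrite -subr_eq0; apply/eqP.
apply: (@modular_eq0 _ q n (fun mu => Zsum wt1 n mu - Zsum wt2 n mu)) => //.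
  split=> [mu1 mu2 e|nu u j hnu uj nuj t o|nu j r hnu jn rj nuj nuj1 o].
  - by rewrite !(eq_Zsum _ e).
  - by rewrite !mulrBr !(Zsum_modular_left two_neq0 _ hnu uj) //; ring.
  - by rewrite !mulrBr !(Zsum_modular_right two_neq0 _ hnu jn rj) //; ring.
by move=> nu hnu aligned; rewrite Zsum_cliques ?subrr.
Qed.
End Comparison.

(** * The two weights: colours and columns *)

Section ColorWeight.
Variables (K : fieldType) (q : K) (N : nat) (x : 'I_N -> K).

Definition color_factor (c p : 'I_N) : K :=
  if p == c then 0 else if (c < p)%N then q else 1.

Definition color_weight (M : seq 'I_N) (c : 'I_N) : K :=
  x c * \prod_(p <- M) color_factor c p.

Lemma color_weight_cons p M c :
  color_weight (p :: M) c = color_factor c p * color_weight M c.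
Proof. by rewrite /color_weight big_cons mulrCA. Qed.

(** All weights factor through the pairwise comparisons of three colours, which
    leaves finitely many orders to check. *)
Lemma color_weight_modular : modular_weight q color_weight.
Proof.
split.
- by move=> M M' c MM'; rewrite /color_weight (perm_big _ MM').
- move=> M c cM; rewrite /color_weight (big_rem c cM) /=.
  by rewrite {1}/color_factor eqxx mul0r mulr0.
- move=> L M p p' c pp _ _; rewrite !color_weight_cons.
  move: (color_weight L p) (color_weight L p') (color_weight M c) => a b w.
  rewrite /color_factor -!val_eqE /=; move: pp; rewrite -val_eqE /=.
  by case: ltngtP => // pp _; case: ltngtP => // cp;
     case: ltngtP => // cp'; try lia; ring.
- move=> L p c c' _ cc; rewrite !color_weight_cons.
  move: (color_weight L c) (color_weight L c') => a b.
  rewrite /color_factor -!val_eqE /=; move: cc; rewrite -val_eqE /=.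
  by case: ltngtP => // pp _; case: ltngtP => // cp;
     case: ltngtP => // cp'; try lia; ring.
Qed.
End ColorWeight.

Section ColumnWeight.
Variables (K : fieldType) (q : K) (G : nat -> K).
Hypothesis qint_neq0 : forall k, qint q k.+1 != 0.
Hypothesis q_neq0 : q != 0.
Hypothesis q_neq1 : q != 1.

Let y (c : nat) : K := q ^+ c.

Definition active (M : seq nat) (c : nat) : bool := (c == 0) || (c.-1 \in M).

(** For z = q^-c this is (z - q^-p) / (z - q^-(p+1)).  At the pole c = p+1, the
    residue is absorbed by [column_base]. *)
Definition column_factor (c p : nat) : K :=
  if c == p.+1 then 1 else q * (y p - y c) / (q * y p - y c).

Definition column_base (c : nat) : K := if c is 0 then 1 else (qint q c)^-1.

(** Up to the factor G c, this is the residue at z = q^-c of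
    (z-1)^-1 prod_(p in M) (z - q^-p) / (z - q^-(p+1)), which is Hikita's
    transition probability to the column c evaluated at q^-1, where M is the
    set of the columns whose largest entry exceeds r.  Telescoping over the
    runs of consecutive columns in M gives back his formula. *)
Definition column_weight (M : seq nat) (c : nat) : K :=
  G c * column_base c * (active M c)%:R * \prod_(p <- M) column_factor c p.

Lemma powers_neq a b : a != b -> y a != y b.
Proof.
have lt i j : (i < j)%N -> y i != y j.
  move=> ij; rewrite -subr_eq0 -opprB oppr_eq0 /y -[j](subnKC (ltnW ij)) exprD -{2}[q ^+ i]mulr1.
  rewrite -mulrBr mulf_neq0 ?expf_neq0 // subrX1 mulf_neq0 ?subr_eq0 //.
  by have := qint_neq0 (j - i.+1); rewrite -subSn // subSS.
by rewrite neq_ltn => /orP[/lt//|/lt]; rewrite eq_sym.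
Qed.

Lemma column_factor_den c p : c != p.+1 -> q * y p - y c != 0.
Proof. by move=> cp; rewrite subr_eq0 /y -exprS powers_neq // eq_sym. Qed.

Definition rest_weight M c := G c * column_base c * \prod_(p <- M) column_factor c p.

Lemma active_cons p M c : active (p :: M) c = (c == p.+1) || active M c.
Proof. by case: c => [|c]; rewrite /active //= inE. Qed.

Lemma column_weightE M c : column_weight M c = (active M c)%:R * rest_weight M c.
Proof. by rewrite /column_weight /rest_weight mulrCA mulrA. Qed.

Lemma rest_weight_cons p M c : rest_weight (p :: M) c = column_factor c p * rest_weight M c.
Proof. by rewrite /rest_weight big_cons mulrCA. Qed.

Lemma column_factor_self c : column_factor c c = 0.
Proof. by rewrite /column_factor (ltn_eqF (ltnSn c)) subrr mulr0 mul0r. Qed.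

Lemma column_weight_mem (M : seq nat) c : c \in M -> column_weight M c = 0.
Proof.
move=> cM; rewrite /column_weight (big_rem c cM) /= column_factor_self.
by rewrite mul0r mulr0.
Qed.

Lemma column_weight_perm (M M' : seq nat) c :
  perm_eq M M' -> column_weight M c = column_weight M' c.
Proof.
move=> MM'; rewrite /column_weight (perm_big _ MM') /active.
by rewrite (perm_mem MM').
Qed.

(** The two orders in which p and p' can receive a box differ only by the factor
    between p and p'. *)
Lemma column_exchange (L : seq nat) p p' : p != p' ->
  column_weight L p * column_weight (p :: L) p' * (q * y p - y p') =
  column_weight L p' * column_weight (p' :: L) p * (y p - q * y p').
Proof.
have main (i j : nat) : j = i.+1 ->
    column_weight L j * column_weight (j :: L) i = 0.
  move=> ->; rewrite column_weightE {1}/active /=.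
  case: (boolP (i \in L)) => iL; last by rewrite !mul0r.
  by rewrite [X in _ * X]column_weight_mem ?mulr0 // inE iL orbT.
move=> pp; case: (eqVneq p' p.+1) => [e|p'p].
  by rewrite (main _ _ e) mul0r e /y exprS subrr mulr0.
case: (eqVneq p p'.+1) => [e|pp'].
  by rewrite (main _ _ e) mul0r e /y exprS subrr mulr0.
rewrite !column_weightE !active_cons !rest_weight_cons (negPf p'p) (negPf pp') /=.
rewrite /column_factor (negPf p'p) (negPf pp').
have := column_factor_den p'p; have := column_factor_den pp'.
move: (y p) (y p') => z z' h h'; field; rewrite h h' //.
Qed.

(** By [column_exchange] the two weights in the local condition are in the ratio
    of y p - q y p' to q y p - y p'.  With these in their place, the condition
    becomes an identity between rational functions of the powers of q, or one
    of its residues when c is next to p or p'. *)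
Lemma column_local_left_core (M : seq nat) p p' c :
    p != p' -> p \notin M -> p' \notin M ->
  (y p - q * y p') * ((1 + q) * column_weight (p' :: M) c - q * column_weight M c
     - column_weight (p :: p' :: M) c) +
  (q * y p - y p') * ((1 + q) * column_weight (p :: M) c - q * column_weight M c
     - column_weight (p' :: p :: M) c) = 0.
Proof.
move=> pp pM p'M; rewrite !column_weightE !active_cons !rest_weight_cons.
move: (rest_weight M c) => w; have ypp := powers_neq pp.
have q1 : q + 1 != 0 by have := qint_neq0 1; rewrite qintS qint1 expr1 addrC.
case: (eqVneq c p'.+1) => [cp'|cp'].
  have -> : active M c = false by rewrite cp' /active /= (negPf p'M).
  have -> : (c == p.+1) = false by apply/negbTE; rewrite cp' eqSS eq_sym.
  rewrite /column_factor cp' eqxx eqSS eq_sym (negPf pp) /= /y exprS -/(y p) -/(y p').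
  have h : y p - y p' != 0 by rewrite subr_eq0.
  have h2 : q * y p - q * y p' != 0 by rewrite -mulrBr mulf_neq0.
  by field; rewrite ?h ?h2.
case: (eqVneq c p.+1) => [cp|cp].
  have -> : active M c = false by rewrite cp /active /= (negPf pM).
  rewrite /column_factor cp eqxx eqSS (negPf pp) /= /y exprS -/(y p) -/(y p').
  have h : y p' - y p != 0 by rewrite subr_eq0 eq_sym.
  have h2 : q * y p' - q * y p != 0 by rewrite -mulrBr mulf_neq0.
  by field; rewrite ?h ?h2.
rewrite /column_factor (negPf cp) (negPf cp') /=.
have := column_factor_den cp; have := column_factor_den cp'.
by move: (y p) (y p') (y c) => z z' zc h h'; field; rewrite h h'.
Qed.

Lemma column_local_left (L M : seq nat) p p' c : p != p' -> p \notin M -> p' \notin M ->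
  column_weight L p * column_weight (p :: L) p' *
    ((1 + q) * column_weight (p' :: M) c - q * column_weight M c
       - column_weight (p :: p' :: M) c) +
  column_weight L p' * column_weight (p' :: L) p *
    ((1 + q) * column_weight (p :: M) c - q * column_weight M c
       - column_weight (p' :: p :: M) c) = 0.
Proof.
move=> pp pM p'M; have core := column_local_left_core c pp pM p'M.
have exch := column_exchange L pp.
move: core exch; set a := _ * column_weight (p :: L) p'.
set b := _ * column_weight (p' :: L) p.
set X := _ - column_weight (p :: p' :: M) c; set Y := _ - column_weight _ c.
move=> core exch.
case: (eqVneq (q * y p - y p') 0) => [e0|h].
  have h : y p - q * y p' != 0.
    have : (1 + q) * (y p - y p') != 0.
      rewrite mulf_neq0 ?subr_eq0 ?powers_neq //.
      by have := qint_neq0 1; rewrite qintS qint1 expr1.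
    apply: contraNneq => e1.
    have -> : (1 + q) * (y p - y p') = (y p - q * y p') + (q * y p - y p') by ring.
    by rewrite e1 e0 addr0.
  apply: (mulfI h); rewrite mulr0.
  have : (y p - q * y p') * (a * X + b * Y) =
      a * ((y p - q * y p') * X + (q * y p - y p') * Y) +
      (b * (y p - q * y p') - a * (q * y p - y p')) * Y by ring.
  by move->; rewrite core exch subrr mul0r mulr0 addr0.
apply: (mulfI h); rewrite mulr0.
have : (q * y p - y p') * (a * X + b * Y) =
    b * ((y p - q * y p') * X + (q * y p - y p') * Y) +
    (a * (q * y p - y p') - b * (y p - q * y p')) * X by ring.
by move->; rewrite core exch subrr mul0r mulr0 addr0.
Qed.

(** All terms have the weights of c and c' over L as common factors; what is left
    is a rational identity in the powers of q, or one of its residues when two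
    of p, c, c' are next to each other. *)
Lemma column_local_right_core (L : seq nat) p c c' :
    p \notin L -> c \notin L -> c' \notin L -> c != c' -> c' != p.+1 ->
  (1 + q) * (column_weight (p :: L) c * column_weight (c :: L) c')
    - q * (column_weight L c * column_weight (c :: L) c')
    - column_weight (p :: L) c * column_weight (c :: p :: L) c' +
  ((1 + q) * (column_weight (p :: L) c' * column_weight (c' :: L) c)
    - q * (column_weight L c' * column_weight (c' :: L) c)
    - column_weight (p :: L) c' * column_weight (c' :: p :: L) c) = 0.
Proof.
move=> pL cL c'L cc c'p; rewrite !column_weightE !active_cons !rest_weight_cons.
move: (rest_weight L c) (rest_weight L c') => w w'; rewrite (negPf c'p) /=.
have q1 : q + 1 != 0 by have := qint_neq0 1; rewrite qintS qint1 expr1 addrC.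
have succ_inactive i j : j \notin L -> i = j.+1 -> active L i = false.
  by move=> jL ->; rewrite /active /= (negPf jL).
have fself i : column_factor i.+1 i = 1 by rewrite /column_factor eqxx.
have fE i j : i != j.+1 -> column_factor i j = q * (y j - y i) / (q * y j - y i).
  by rewrite /column_factor => /negPf->.
case: (eqVneq c p.+1) => [cp|cp] /=.
  have acF := succ_inactive _ _ pL cp.
  case: (eqVneq c c'.+1) => [cc'|cc'].
    have c'E : c' = p by apply/eqP; rewrite -eqSS -cc' cp.
    rewrite acF c'E cp column_factor_self !fself /=.
    have pp : p != p.+2 by lia.
    rewrite (fE _ _ pp) (_ : (p == p.+2) = false) /=; last exact: negbTE.
    rewrite /y exprS -/(y p).
    have h : q * (q * y p) - y p = (q - 1) * (q + 1) * y p by ring.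
    have h0 : q * (q * y p) - y p != 0.
      by rewrite h !mulf_neq0 // ?subr_eq0 // /y expf_neq0.
    by field; rewrite ?h0.
  case: (eqVneq c' c.+1) => [c'c|c'c].
    rewrite acF (succ_inactive _ _ cL c'c) c'c cp !fself /=.
    have pp : p.+2 != p.+1 by lia.
    rewrite (fE _ _ pp) /y !exprS -/(y p).
    have h0 : q * y p - q * (q * y p) != 0.
      have -> : q * y p - q * (q * y p) = - (q * (q - 1) * y p) by ring.
      by rewrite oppr_eq0 !mulf_neq0 // ?subr_eq0 // /y expf_neq0.
    by field; rewrite ?h0.
  rewrite acF /= (fE _ _ c'c) (fE _ _ c'p) (fE _ _ cc') cp fself /y !exprS.
  rewrite -/(y p) -/(y c').
  have := column_factor_den c'c; have := column_factor_den c'p.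
  have := column_factor_den cc'; rewrite cp /y !exprS -/(y p) -/(y c').
  by move: (y p) (y c') => z z' h1 h2 h3; field; rewrite ?h1 ?h2 ?h3.
case: (eqVneq c' c.+1) => [c'c|c'c].
  rewrite (succ_inactive _ _ cL c'c) c'c !fself /= (fE _ _ cp) -c'c (fE _ _ c'p).
  have := column_factor_den cp; have := column_factor_den c'p.
  rewrite c'c /y !exprS -/(y p) -/(y c).
  by move: (y p) (y c) => z z' h1 h2; field; rewrite ?h1 ?h2.
case: (eqVneq c c'.+1) => [cc'|cc'].
  rewrite (succ_inactive _ _ c'L cc') cc' !fself /= (fE _ _ c'p) -cc' (fE _ _ cp).
  have := column_factor_den cp; have := column_factor_den c'p.
  rewrite cc' /y !exprS -/(y p) -/(y c').
  by move: (y p) (y c') => z z' h1 h2; field; rewrite ?h1 ?h2.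
rewrite !fE //= -/(y c) -/(y c').
have := column_factor_den cp; have := column_factor_den c'p.
have := column_factor_den c'c; have := column_factor_den cc'.
move: (y p) (y c) (y c') => z zc zc' h1 h2 h3 h4.
by field; rewrite ?h1 ?h2 ?h3 ?h4.
Qed.

Lemma column_local_right (L : seq nat) p c c' : p \notin L -> c != c' ->
  (1 + q) * (column_weight (p :: L) c * column_weight (c :: L) c')
    - q * (column_weight L c * column_weight (c :: L) c')
    - column_weight (p :: L) c * column_weight (c :: p :: L) c' +
  ((1 + q) * (column_weight (p :: L) c' * column_weight (c' :: L) c)
    - q * (column_weight L c' * column_weight (c' :: L) c)
    - column_weight (p :: L) c' * column_weight (c' :: p :: L) c) = 0.
Proof.
have zero i j : i \in L ->
  (1 + q) * (column_weight (p :: L) i * column_weight (i :: L) j)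
    - q * (column_weight L i * column_weight (i :: L) j)
    - column_weight (p :: L) i * column_weight (i :: p :: L) j +
  ((1 + q) * (column_weight (p :: L) j * column_weight (j :: L) i)
    - q * (column_weight L j * column_weight (j :: L) i)
    - column_weight (p :: L) j * column_weight (j :: p :: L) i) = 0.
  move=> iL; have z M : i \in M -> column_weight M i = 0 by exact: column_weight_mem.
  rewrite (z (p :: L)) ?(z L) ?(z (j :: L)) ?(z [:: j, p & L]) ?inE ?iL ?orbT //.
  by rewrite !mul0r !mulr0 !subr0 addr0.
move=> pL cc; case: (boolP (c \in L)) => cL; first exact: zero.
case: (boolP (c' \in L)) => c'L; first by rewrite addrC; exact: zero.
case: (eqVneq c' p.+1) => c'p; last exact: column_local_right_core.
rewrite addrC; apply: column_local_right_core => //; first by rewrite eq_sym.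
by rewrite -c'p.
Qed.

Variable B : nat.

Lemma column_weight_modular :
  modular_weight q (fun (M : seq 'I_B) c => column_weight (map val M) (val c)).
Proof.
split.
- by move=> M M' c MM'; apply/column_weight_perm/perm_map.
- by move=> M c cM; apply/column_weight_mem/map_f.
- move=> L M p p' c pp pM p'M; apply: column_local_left => //.
    by rewrite mem_map //; apply: val_inj.
  by rewrite mem_map //; apply: val_inj.
- move=> L p c c' pL cc; apply: column_local_right => //.
  by rewrite mem_map //; apply: val_inj.
Qed.
End ColumnWeight.

(** * Summation vertex by vertex, and the values on cliques *)

Section Recursion.
Variables (K : fieldType) (C : finType) (wt : seq C -> C -> K) (mu : nat -> nat).

(** The same sum, one vertex at a time and with a test function Phi on the word of
    all values. *)
Fixpoint Zrec (n : nat) (Phi : seq C -> K) : K :=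
  if n is n'.+1 then
    Zrec n' (fun s => \sum_c wt (drop (mu n') s) c * Phi (rcons s c))
  else Phi [::].

Lemma eq_Zrec n Phi Psi :
  (forall s, size s = n -> Phi s = Psi s) -> Zrec n Phi = Zrec n Psi.
Proof.
elim: n Phi Psi => [|n IHn] Phi Psi e /=; first exact: e.
apply: IHn => s sn; apply: eq_bigr => c _; rewrite e //.
by rewrite size_rcons sn.
Qed.

Lemma Zrec_scale n a Phi : Zrec n (fun s => a * Phi s) = a * Zrec n Phi.
Proof.
elim: n Phi => //= n IHn Phi; rewrite -IHn; apply: eq_Zrec => s _.
by rewrite big_distrr; apply: eq_bigr => c _; rewrite mulrCA.
Qed.

Lemma Zrec_sum n (I : Type) (r : seq I) (P : pred I) (Phi : I -> seq C -> K) :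
  Zrec n (fun s => \sum_(i <- r | P i) Phi i s) = \sum_(i <- r | P i) Zrec n (Phi i).
Proof.
elim: n Phi => //= n IHn Phi; rewrite -IHn; apply: eq_Zrec => s _.
rewrite exchange_big; apply: eq_bigr => c _; by rewrite big_distrr.
Qed.

Hypothesis wt_perm : forall M M' c, perm_eq M M' -> wt M c = wt M' c.

Lemma Zrec_Zsum n Phi : Zrec n Phi =
  \sum_(kap : {ffun 'I_n -> C})
    (\prod_k wt (map kap (window mu k)) (kap k)) * Phi (map kap (enum 'I_n)).
Proof.
elim: n Phi => [|n IHn] Phi /=.
  rewrite (eq_bigr (fun=> Phi [::])) => [|kap _]; last by rewrite big_ord0 mul1r enum_ord0.
  by rewrite sumr_const card_ffun card_ord expn0 mulr1n.
rewrite IHn; pose W := widen_ord (leqnSn n).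
pose glue (p : {ffun 'I_n -> C} * C) : {ffun 'I_n.+1 -> C} :=
  [ffun i => if unlift ord_max i is Some j then p.1 j else p.2].
have W_lift j : W j = lift ord_max j by apply/val_inj; apply/esym/lift_max.
have glueW p j : glue p (W j) = p.1 j by rewrite ffunE W_lift liftK.
have glue_max p : glue p ord_max = p.2 by rewrite ffunE unlift_none.
rewrite [RHS](reindex glue); last first.
  exists (fun kap : {ffun 'I_n.+1 -> C} => ([ffun j => kap (W j)], kap ord_max)) =>
    [[x c] _|kap _].
    by rewrite glue_max; congr (_, _); apply/ffunP => j; rewrite ffunE glueW.
  apply/ffunP => i; rewrite ffunE; case: unliftP => [j|] -> //=.
  by rewrite ffunE W_lift.
under [LHS]eq_bigr do rewrite mulr_sumr.
rewrite pair_bigA; apply: eq_bigr => -[x c] _ /=; rewrite mulrA big_ord_recr /=.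
have mapW s : map (glue (x, c)) (map W s) = map x s.
  by rewrite -map_comp; apply: eq_map => i; rewrite /= glueW.
rewrite glue_max enum_ordSr map_rcons glue_max mapW /=.
congr (_ * _ * _).
  apply: eq_bigr => j _; rewrite glueW.
  rewrite -mapW; apply: wt_perm.
  apply/perm_map/uniq_perm; rewrite ?window_uniq // ?map_inj_uniq ?window_uniq //.
    by move=> i1 i2 /(congr1 val) /= e; apply/val_inj.
  move=> i; rewrite mem_window /=; apply/mapP/idP => [[i' + ->]|ij].
    by rewrite mem_window.
  have i_n : (i < n)%N by have := ltn_ord j; lia.
  by exists (Ordinal i_n); [rewrite mem_window | apply/val_inj].
apply: wt_perm; rewrite -map_drop.
rewrite -mapW.
apply/perm_map/uniq_perm.
- rewrite map_inj_uniq ?drop_uniq ?enum_uniq //.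
  by move=> i1 i2 /(congr1 val) /= e; apply/val_inj.
- exact: window_uniq.
move=> i; rewrite mem_window /=.
have drop_mem (j : 'I_n) : (j \in drop (mu n) (enum 'I_n)) = (mu n <= j)%N.
  rewrite -(mem_map val_inj) map_drop val_enum_ord drop_iota add0n mem_iota /=.
  by have := ltn_ord j; lia.
apply/mapP/idP => [[i' + ->]|ij] /=.
  by rewrite drop_mem => ->; rewrite /= ltn_ord.
have i_n : (i < n)%N by lia.
exists (Ordinal i_n); last exact: val_inj.
by rewrite drop_mem /=; lia.
Qed.

Lemma Zrec1 n : Zrec n (fun=> 1) = Zsum wt n mu.
Proof. by rewrite Zrec_Zsum; apply: eq_bigr => kap _; rewrite mulr1. Qed.
End Recursion.

Lemma qfactS (R : pzRingType) (q : R) m : qfact q m.+1 = qfact q m * qint q m.+1.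
Proof. by rewrite /qfact big_nat_recr. Qed.

Lemma qfact0 (R : pzRingType) (q : R) : qfact q 0 = 1.
Proof. by rewrite /qfact big_geq. Qed.

Section ColorClique.
Variables (K : fieldType) (q : K) (N : nat) (x : 'I_N -> K).

Definition color_esum (a : nat) : K :=
  \sum_(S : {set 'I_N} | #|S| == a) \prod_(i in S) x i.

(** Every other element of S lies above the smallest one. *)
Lemma sum_q_above (S : {set 'I_N}) :
  \sum_(c in S) q ^+ #|[set p in S | (c < p)%N]| = qint q #|S|.
Proof.
have [k] := ubnP #|S|; elim: k S => // k IHk S Sk.
case: (set_0Vmem S) => [->|[c cS]]; first by rewrite big_set0 cards0 qint0.
case: (arg_minnP (fun i : 'I_N => val i) cS) => c0 /= c0S' c0_min {c cS}.
have c0S : c0 \in S by [].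
rewrite (bigD1 c0) //= (cardsD1 c0 S) c0S add1n qintS addrC; congr (_ + _).
  rewrite -IHk; last by move: Sk; rewrite (cardsD1 c0 S) c0S.
  rewrite (eq_bigl (mem (S :\ c0))) => [|c]; last by rewrite !inE andbC.
  apply: eq_bigr => c cS; congr (_ ^+ #|pred_of_set _|); apply/setP => p; rewrite !inE.
  case: eqVneq => [->|//] /=; apply/negbTE; rewrite negb_and -leqNgt.
  by case/setD1P: cS => _ /c0_min ->; rewrite orbT.
congr (_ ^+ #|pred_of_set _|); apply/setP => p; rewrite !inE andbC.
case: (boolP (p \in S)) => [pS|]; last by rewrite !andbF.
by rewrite !andbT ltn_neqAle c0_min // andbT eq_sym.
Qed.

Let Z := Zrec (color_weight q x) (fun=> 0%N).

(** On a clique only injective words have a nonzero weight. *)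
Lemma eq_Zrec_uniq a Phi Psi :
  (forall s, uniq s -> size s = a -> Phi s = Psi s) -> Z a Phi = Z a Psi.
Proof.
rewrite /Z; elim: a Phi Psi => [|a IHa] Phi Psi e /=; first exact: e.
apply: IHa => s us sa; apply: eq_bigr => c _; rewrite drop0.
case: (boolP (c \in s)) => cs; last by rewrite e ?size_rcons ?sa // rcons_uniq cs.
case: (color_weight_modular q x) => _ mem0 _ _.
by rewrite mem0 // !mul0r.
Qed.

(** Sum over the colour c of the last vertex: the other vertices use the rest of
    S, and those with a colour above c form inversions with it. *)
Lemma color_clique_set (S : {set 'I_N}) :
  Z #|S| (fun s => (perm_eq s (enum S))%:R) = qfact q #|S| * \prod_(i in S) x i.
Proof.
have [a Sa] : exists a, #|S| = a by exists #|S|.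
rewrite Sa; elim: a S Sa => [|a IHa] S Sa.
  have -> : S = finset.set0 by apply/eqP; rewrite -cards_eq0 Sa.
  by rewrite /Z /= big_set0 qfact0 enum_set0 mulr1.
rewrite [LHS](_ : _ = Z a (fun s => \sum_(c in S)
    q ^+ #|[set p in S | (c < p)%N]| * x c * (perm_eq s (enum (S :\ c)))%:R)).
  rewrite /Z Zrec_sum.
  transitivity (\sum_(c in S) q ^+ #|[set p in S | (c < p)%N]| *
    (qfact q a * \prod_(i in S) x i)).
    apply: eq_bigr => c cS; rewrite Zrec_scale -/(Z _ _) IHa.
      by rewrite (big_setD1 c cS) /= -!mulrA; congr (_ * _); rewrite mulrCA.
    by move: Sa; rewrite (cardsD1 c S) cS => -[].
  by rewrite -mulr_suml sum_q_above Sa qfactS; ring.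
rewrite /Z /=; apply: eq_Zrec => s _; rewrite drop0 [RHS]big_mkcond; apply: eq_bigr => c _.
have permE : perm_eq (rcons s c) (enum S) = (c \in S) && perm_eq s (enum (S :\ c)).
  rewrite perm_rcons; apply/idP/andP => [p_cs|[cS sE]].
    have cS : c \in S by rewrite -mem_enum -(perm_mem p_cs) mem_head.
    split=> //; rewrite -(perm_cons c) (perm_trans p_cs) //.
    apply: uniq_perm; rewrite ?enum_uniq //= ?mem_enum ?setD11 ?enum_uniq //.
    by move=> i; rewrite inE !mem_enum !inE; case: eqP => [->|].
  rewrite -(perm_cons c) in sE; apply: (perm_trans sE).
  apply: uniq_perm; rewrite ?enum_uniq //= ?mem_enum ?setD11 ?enum_uniq //.
  by move=> i; rewrite inE !mem_enum !inE; case: eqP => [->|].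
rewrite permE; case: (boolP (c \in S)) => cS; last by rewrite mulr0.
case: (boolP (perm_eq _ _)) => [sE|]; last by rewrite !mulr0.
rewrite !mulr1 /color_weight (perm_big _ sE) /= big_enum /= mulrC; congr (_ * _).
rewrite (eq_bigr (fun p : 'I_N => if (c < p)%N then q else 1)) => [|p]; last first.
  by rewrite /color_factor !inE => /andP[/negPf->].
rewrite -big_mkcondr /= prodr_const; congr (_ ^+ _).
apply: eq_card => p; rewrite inE [LHS]unfold_in /= !inE.
by case: eqVneq => [->|]; rewrite ?ltnn ?andbF.
Qed.

Lemma color_clique a :
  Zsum (color_weight q x) a (fun=> 0%N) = qfact q a * color_esum a.
Proof.
case: (color_weight_modular q x) => wt_perm _ _ _.
rewrite -Zrec1 // -/(Z a _).
rewrite (@eq_Zrec_uniq _ _ (fun s => \sum_(S : {set 'I_N} | #|S| == a)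
   (perm_eq s (enum S))%:R)).
  rewrite /Z Zrec_sum /color_esum mulr_sumr; apply: eq_bigr => S /eqP <-.
  exact: color_clique_set.
move=> s us sa; pose S := [set i in s].
have sE : perm_eq s (enum S).
  by apply: uniq_perm; rewrite ?enum_uniq // => i; rewrite mem_enum inE.
have Sa : #|S| == a by rewrite cardE -(perm_size sE) sa.
rewrite (bigD1 S) //= sE big1 ?addr0 // => S' /andP[_ SS'].
case: (boolP (perm_eq _ _)) => // sE'; case/eqP: SS'; apply/setP => i.
by rewrite inE (perm_mem sE') mem_enum.
Qed.
End ColorClique.

Section ColumnClique.
Variables (K : fieldType) (q : K) (G : nat -> K).
Hypothesis qint_neq0 : forall k, qint q k.+1 != 0.

Lemma telescope_below c k : (k < c)%N ->
  \prod_(p <- iota 0 k) (qint q (c - p) / qint q (c - p.+1)) = qint q c / qint q (c - k).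
Proof.
elim: k => [|k IHk] kc; first by rewrite big_nil subn0 divff // -(prednK kc).
rewrite -addn1 iotaD big_cat IHk ?(ltnW kc) //= big_seq1 add0n addn1.
have h : qint q (c - k) != 0 by have -> : (c - k = (c - k.+1).+1)%N by lia.
rewrite mulrA divfK //.
Qed.

Hypothesis q_neq0 : q != 0.
Hypothesis q_neq1 : q != 1.

Lemma expr_qint m : q ^+ m = 1 + (q - 1) * qint q m.
Proof. by rewrite -subrX1 addrC subrK. Qed.

(** Rewriting the factors with q-integers shows which power of q they contain. *)
Lemma column_factor_below c p : (p.+1 < c)%N ->
  column_factor q c p = qint q (c - p) / qint q (c - p.+1).
Proof.
move=> pc; rewrite /column_factor ifF; last by apply/negbTE; lia.
have [k ->] : exists k, c = (p + k.+2)%N by exists (c - p.+2)%N; lia.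
rewrite addKn addnS subSS addKn -!addnS exprD.
have q10 : q - 1 != 0 by rewrite subr_eq0.
have qp : q ^+ p != 0 by rewrite expf_neq0.
have -> : q * q ^+ p - q ^+ p * q ^+ k.+2 = - q ^+ p * q * (q - 1) * qint q k.+1.
  by rewrite exprS [q ^+ k.+1]expr_qint; ring.
rewrite [q ^+ k.+2]expr_qint; have := qint_neq0 k; move: (q ^+ p) qp => z z0 h.
by field; rewrite ?oppr_eq0 ?h ?z0 ?q10 ?q_neq0.
Qed.

Lemma column_factor_above c p : (c < p)%N ->
  column_factor q c p = q * (qint q (p - c) / qint q (p.+1 - c)).
Proof.
move=> cp; rewrite /column_factor ifF; last by apply/negbTE; lia.
have [k ->] : exists k, p = (c + k.+1)%N by exists (p - c.+1)%N; lia.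
rewrite -addnS !addKn exprD.
have q10 : q - 1 != 0 by rewrite subr_eq0.
have qc : q ^+ c != 0 by rewrite expf_neq0.
have -> : q * (q ^+ c * q ^+ k.+1) - q ^+ c = q ^+ c * (q - 1) * qint q k.+2.
  by rewrite mulrCA -exprS [q ^+ k.+2]expr_qint; ring.
rewrite [q ^+ k.+1]expr_qint; have := qint_neq0 k.+1; move: (q ^+ c) qc => z z0 h.
by field; rewrite ?oppr_eq0 ?h ?z0 ?q10 ?q_neq0.
Qed.

(** When all columns before c are marked, the box goes to c with probability 1. *)
Lemma column_base_full c :
  column_base q c * \prod_(p <- iota 0 c) column_factor q c p = 1.
Proof.
case: c => [|c]; first by rewrite big_nil mulr1.
rewrite -addn1 iotaD big_cat /= big_seq1 add0n addn1 /column_factor eqxx mulr1.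
rewrite big_seq (eq_bigr (fun p => qint q (c.+1 - p) / qint q (c.+1 - p.+1))); last first.
  move=> p; rewrite mem_iota add0n => pc.
  by apply: column_factor_below; lia.
by rewrite -big_seq telescope_below // subSnn qint1 divr1 mulVf.
Qed.

(** On a clique the boxes fill the columns 0, 1, 2, ... in this order. *)
Lemma column_clique B a : (a <= B)%N ->
  Zsum (fun (M : seq 'I_B) c => column_weight q G (map val M) (val c)) a (fun=> 0%N)
    = \prod_(0 <= c < a) G c.
Proof.
move=> aB; have [wt_perm _ _ _] := column_weight_modular G qint_neq0 q_neq0 q_neq1 B.
rewrite -Zrec1 //.
suff -> Phi : Zrec (fun (M : seq 'I_B) c => column_weight q G (map val M) (val c))
    (fun=> 0%N) a Phi = \prod_(0 <= c < a) G c * Phi (take a (enum 'I_B)).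
  by rewrite mulr1.
elim: a aB Phi => [|a IHa] aB Phi /=; first by rewrite big_geq // mul1r take0.
rewrite IHa ?(ltnW aB) // drop0 big_nat_recr //= -mulrA; congr (_ * _).
have iotaE : map val (take a (enum 'I_B)) = iota 0 a.
  by rewrite map_take val_enum_ord take_iota (minn_idPl _) // ltnW.
rewrite iotaE (bigD1 (Ordinal aB)) //= big1 ?addr0 => [|c ca].
  congr (_ * Phi _); last first.
    by rewrite (take_nth (Ordinal aB)) ?size_enum_ord // ?(nth_ord_enum _ (Ordinal aB)).
  rewrite /column_weight (_ : active _ _ = true) ?mulr1; last first.
    by rewrite /active mem_iota; lia.
  by rewrite -mulrA column_base_full mulr1.
rewrite -val_eqE /= in ca; case: (ltngtP c a) ca => // ca _.
  by rewrite column_weight_mem ?mul0r // mem_iota.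
rewrite /column_weight (_ : active _ _ = false) ?(mulr0, mul0r) //.
by rewrite /active mem_iota; lia.
Qed.
End ColumnClique.

(** * The columns to which a box can be added *)

(** The positions at which the blocks of odd index start, when the blocks with
    sizes bl are laid out from p on. *)
Fixpoint odd_starts (p : nat) (bl : seq nat) : seq nat :=
  match bl with
  | b :: a :: bl' => (p + b)%N :: odd_starts (p + b + a) bl'
  | _ => [::]
  end.

(** The positions of the zeros that follow a one, where s starts at the position
    o and x is the bit before it. *)
Fixpoint falls (x : bool) (o : nat) (s : seq bool) : seq nat :=
  if s is y :: s' then
    if x && ~~ y then o :: falls y o.+1 s' else falls y o.+1 s'
  else [::].

Lemma run_lengths_size x k s : (0 < size (run_lengths x k s))%N.
Proof. by elim: s k => //= y s IHs k; case: ifP. Qed.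

(** Blocks of ones and zeros alternate, so the falls are the starts of the blocks
    of zeros.  The two statements follow the run in progress, which is one of
    ones or one of zeros and has k bits so far. *)
Lemma falls_run_lengths s p k :
  odd_starts p (run_lengths true k s) = falls true (p + k) s /\
  odd_starts (p + head 0%N (run_lengths false k s)) (behead (run_lengths false k s))
    = falls false (p + k) s.
Proof.
elim: s p k => [|[] s IHs] p k //=.
  by have [-> _] := IHs p k.+1; have [] := IHs (p + k)%N 1%N; rewrite addn1 addnS.
have [_] := IHs (p + k)%N 1%N; have [_] := IHs p k.+1; rewrite addn1 addnS.
have := run_lengths_size false 1 s.
by case: (run_lengths false 1 s) => [|a l] //= _ -> ->.
Qed.

Lemma odd_startsE p bl :
  odd_starts p bl = [seq (p + sumn (take k.*2.+1 bl))%N | k <- iota 0 (size bl)./2].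
Proof.
have [N] := ubnP (size bl); elim: N p bl => // N IHN p [|b [|a bl]] //= szN.
rewrite addn0 IHN; last lia.
rewrite -[1%N]addn0 iotaDl -map_comp; congr (_ :: _); apply: eq_map => k /=.
by rewrite add0n !addnA.
Qed.

Lemma mem_falls x o s c : (c \in falls x o s) =
  [&& (o <= c < o + size s)%N, ~~ nth false s (c - o) &
    (if c == o then x else nth false s (c - o).-1)].
Proof.
elim: s x o => [|y s IHs] x o /=; first by rewrite addn0; case: andP => //; lia.
have e : (c \in falls y o.+1 s) = (c != o) && [&& (o <= c < o + (size s).+1)%N,
    ~~ nth false (y :: s) (c - o) & nth false (y :: s) (c - o).-1].
  rewrite IHs; case: (ltngtP c o) => [co|co|->]; rewrite ?subnn.
  - by rewrite !ifF; lia.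
  - have -> : (c - o = (c - o.+1).+1)%N by lia.
    rewrite /= addSnnS; case: (eqVneq c o.+1) => [->|co1].
      by rewrite subnn.
    by have -> : (c - o.+1 = (c - o.+1).-1.+1)%N by lia.
  - by [].
case: (boolP (x && ~~ y)) => xy; rewrite ?inE e; case: (eqVneq c o) => [->|//] /=.
  by rewrite subnn /= leqnn addnS ltnS leq_addr; case: x y xy {e} => [] [].
by rewrite subnn /=; case: x y xy {e} => [] [] //=; rewrite ?andbF.
Qed.

Lemma falls_sorted x o s : sorted ltn (falls x o s) /\ all (leq o) (falls x o s).
Proof.
elim: s x o => [|y s IHs] x o //=; have [srt /allP ge] := IHs y o.+1.
have le : all (leq o) (falls y o.+1 s) by apply/allP => c /ge /ltnW.
case: (x && ~~ y) => //=; rewrite leqnn le; split => //.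
by rewrite (path_sortedE ltn_trans) srt andbT; apply/allP.
Qed.

Lemma run_lengths_gt0 x k s : all (leq 1) (run_lengths x k.+1 s).
Proof. by elim: s x k => [|y s IHs] x k //=; case: ifP => //= _; rewrite IHs. Qed.

Lemma run_lengths_behead_gt0 x k s : all (leq 1) (behead (run_lengths x k s)).
Proof.
elim: s x k => [|y s IHs] x k //=; case: ifP => //= _; exact: run_lengths_gt0.
Qed.

Section Blocks.
Variables (n r : nat) (T : tableau).
Let bl := blocks n r T.

Definition hikita_column (k : nat) : nat :=
  (\sum_(1 <= i < k.+1) blk_a n r T i + \sum_(0 <= i < k.+1) blk_b n r T i)%N.

Lemma hikita_columnE k : (k.*2.+1 <= size bl)%N ->
  hikita_column k = sumn (take k.*2.+1 bl).
Proof.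
elim: k => [|k IHk] sz.
  rewrite /hikita_column big_geq // big_nat1 add0n /blk_b -/bl.
  by case: (bl) sz => //= b l _; rewrite take0 /= addn0.
have step : hikita_column k.+1 = (hikita_column k + nth 0 bl k.*2.+1 + nth 0 bl k.*2.+2)%N.
  rewrite /hikita_column big_nat_recr // [X in (_ + X)%N]big_nat_recr //=.
  by rewrite /blk_a /blk_b doubleS -/bl /=; lia.
rewrite step IHk; last by move: sz; rewrite doubleS; lia.
rewrite doubleS in sz *.
by rewrite (take_nth 0%N) ?(take_nth 0%N) ?sumn_rcons //; lia.
Qed.

Lemma blocks_gt0 j : (0 < j < size bl)%N -> (0 < nth 0%N bl j)%N.
Proof.
move=> /andP[j0 jb]; have /all_nthP := run_lengths_behead_gt0 true 0 (delta n r T).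
move/(_ 0%N j.-1); rewrite nth_behead prednK // size_behead; apply.
by rewrite -/(blocks n r T) -/bl; lia.
Qed.
Hypothesis last_empty : column_max T n = 0%N.

(** The box of f_k goes to the first column of a block of zeros, and all these
    columns are reached.  Column n is empty, so that delta has a zero. *)
Lemma hikita_columns :
  [seq hikita_column k | k <- iota 0 (blk_len n r T).+1] = falls true 0 (delta n r T).
Proof.
have [e _] := falls_run_lengths (delta n r T) 0 0; rewrite -e odd_startsE.
have szE : (blk_len n r T).+1 = (size bl)./2.
  rewrite /blk_len -/bl prednK //.
  have : size (odd_starts 0 bl) = (size bl)./2 by rewrite odd_startsE size_map size_iota.
  move <-; rewrite e lt0n size_eq0; apply/eqP => e0.
  (* the first unmarked column is a fall *)
  have size_delta : size (delta n r T) = n.+1 by rewrite size_map size_iota.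
  have ex : exists c, ~~ nth false (delta n r T) c.
    exists n; rewrite (nth_map 0%N) ?size_iota // nth_iota // add0n last_empty.
    by rewrite ltn0.
  case: (ex_minnP ex) => c c0 c_min.
  have c_n : (c <= n)%N.
    apply: c_min; rewrite (nth_map 0%N) ?size_iota // nth_iota // add0n last_empty.
    by rewrite ltn0.
  have : c \in falls true 0 (delta n r T).
    rewrite mem_falls size_delta add0n ltnS c_n subn0 c0 /=; case: eqP => // c1.
    by apply/negPn/negP => /c_min; lia.
  by rewrite e0.
rewrite szE; apply/eq_in_map => k; rewrite mem_iota => kb.
by rewrite hikita_columnE // -/bl; lia.
Qed.

End Blocks.

Lemma qint_rmorph (R S : pzRingType) (f : {rmorphism R -> S}) q k :
  qint (f q) k = f (qint q k).
Proof. by rewrite /qint rmorph_sum; apply: eq_bigr => i _; rewrite rmorphXn. Qed.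

Lemma qint_X_neq0 k : qint ('X : {poly int}) k.+1 != 0.
Proof.
apply/eqP => /(congr1 (fun p : {poly int} => p.[1])).
rewrite horner0 /qint horner_sum (eq_bigr (fun=> 1)) => [|i _].
  by rewrite sumr_const card_ord => /eqP; rewrite pnatr_eq0.
by rewrite hornerXn expr1n.
Qed.

Lemma qint_qvar_neq0 k : (0 < k)%N -> qint qvar k != 0.
Proof.
by case: k => // k _; rewrite /qvar qint_rmorph tofrac_eq0 qint_X_neq0.
Qed.

Lemma qvar_neq0 : qvar != 0.
Proof. by rewrite tofrac_eq0 polyX_eq0. Qed.

Lemma hikita_phi_neq0 n r k T :
  (k <= blk_len n r T)%N -> hikita_phi n r k T != 0.
Proof.
move=> kl; have a_gt0 i : (1 <= i <= blk_len n r T)%N -> (0 < blk_a n r T i)%N.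
  by move=> ib; apply: blocks_gt0; move: ib; rewrite /blk_len; lia.
have b_gt0 i : (1 <= i <= blk_len n r T)%N -> (0 < blk_b n r T i)%N.
  by move=> ib; apply: blocks_gt0; move: ib; rewrite /blk_len; lia.
have sum_gt0 (F : nat -> nat) i j x : (i <= x < j)%N -> (0 < F x)%N ->
    (0 < \sum_(i <= y < j) F y)%N.
  move=> /andP[ix xj] Fx; rewrite (big_cat_nat ix (ltnW xj)) /= [X in (_ + X)%N]big_ltn //.
  by apply: leq_trans Fx _; rewrite addnCA leq_addr.
rewrite /hikita_phi; apply: mulf_neq0; [apply: mulf_neq0|].
- by rewrite expf_neq0 // qvar_neq0.
- rewrite prodf_seq_neq0; apply/allP => i; rewrite mem_index_iota => ib /=.
  have bi : (0 < \sum_(i <= j < k.+1) blk_b n r T j)%N.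
    by apply: (sum_gt0 _ _ _ i); [lia|apply: b_gt0; lia].
  by rewrite mulf_neq0 ?invr_neq0 // qint_qvar_neq0 // addn_gt0 bi orbT.
- rewrite prodf_seq_neq0; apply/allP => i; rewrite mem_index_iota => ib /=.
  have ai : (0 < \sum_(k.+1 <= j < i.+1) blk_a n r T j)%N.
    by apply: (sum_gt0 _ _ _ i); [lia|apply: a_gt0; lia].
  by rewrite mulf_neq0 ?invr_neq0 // qint_qvar_neq0 // addn_gt0 ai.
Qed.

(** * Adding a box to a standard tableau *)

Lemma column_of_mem (T : tableau) row i :
  uniq (flatten T) -> row \in T -> i \in row -> column_of T i = index i row.
Proof.
rewrite /column_of; elim: T => //= row' T IHT; rewrite cat_uniq inE.
case/and3P=> u1 disj u2; case: (boolP (i \in row')) => ir'.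
  case/orP => [/eqP->//|rowT irow]; case/hasP: disj; exists i => //.
  by apply/flattenP; exists row.
by case/orP => [/eqP->|rowT irow] /=; [rewrite (negPf ir')|apply: IHT].
Qed.

Lemma height_ltE (T : tableau) c i : sorted geq (shape T) ->
  (i < column_height T c)%N = (c < size (nth [::] T i))%N.
Proof.
rewrite /column_height; elim: T i => [|row T IHT] i; first by rewrite nth_nil.
rewrite /= (path_sortedE (rev_trans leq_trans)) => /andP[/allP le srt].
case: (ltnP c (size row)) => cr.
  by case: i => [|i] /=; rewrite ?cr // add1n ltnS IHT.
have small row' : row' \in T -> (size row' <= c)%N.
  by move=> rT; apply: leq_trans cr; apply: le; apply: map_f.
rewrite add0n (eq_in_count (a2 := pred0)) => [|row' /small]; last by rewrite ltnNge => ->.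
rewrite count_pred0 ltn0; apply/esym/negbTE; rewrite -leqNgt.
case: i => [//|i] /=; case: (ltnP i (size T)) => iT; first by apply/small/mem_nth.
by rewrite nth_default.
Qed.

Lemma sorted_replace (X : eqType) (e : rel X) A a a' D :
    (forall b, b \in A -> e b a -> e b a') -> (forall b, e a b -> e a' b) ->
  sorted e (A ++ a :: D) -> sorted e (A ++ a' :: D).
Proof.
move=> eA eD; have pathD : path e a D -> path e a' D.
  by case: D => //= d D /andP[/eD-> ->].
case: A eA => [|b A] eA //=; rewrite !cat_path /= => /and3P[-> ba /pathD->].
by rewrite (eA _ _ ba) // mem_last.
Qed.

Lemma zip_rcons_short (a b : seq nat) x : (size b <= size a)%N ->
  zip (rcons a x) b = zip a b.
Proof. by elim: a b => [|u a IHa] [|v b] //= /IHa->. Qed.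

Lemma zip_rcons_long (a b : seq nat) x : (size b < size a)%N ->
  zip a (rcons b x) = rcons (zip a b) (nth 0%N a (size b), x).
Proof. by elim: a b => [|u a IHa] [|v b] //= => [_|/IHa->//]; case: a {IHa}. Qed.

Lemma rem_rcons (s : seq nat) x : x \notin s -> rem x (rcons s x) = s.
Proof.
elim: s => [|u s IHs] /=; first by rewrite eqxx.
by rewrite inE negb_or eq_sym => /andP[/negPf-> /IHs->].
Qed.

Lemma standard_uniqE n T : standard n T -> uniq (flatten T).
Proof. by case/and4P=> _ /perm_uniq-> _ _; apply: iota_uniq. Qed.

Section Standard.
Variables (n : nat) (T : tableau).
Hypothesis stT : standard n T.

Lemma standard_facts : [/\ sorted geq (shape T), all (leq 1) (shape T),
  perm_eq (flatten T) (iota 1 n), all (sorted ltn) T &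
  sorted (fun up down => all (fun xy => xy.1 < xy.2)%N (zip up down)) T].
Proof. by case/and4P: stT => /and3P[? ? _] ? ? ?; split. Qed.

Lemma standard_uniq : uniq (flatten T).
Proof. exact: standard_uniqE stT. Qed.

Lemma standard_entry row i : row \in T -> i \in row -> (0 < i <= n)%N.
Proof.
move=> rT ir; have : i \in flatten T by apply/flattenP; exists row.
by case: standard_facts => _ _ /perm_mem-> _ _; rewrite mem_iota add1n ltnS.
Qed.

Lemma standard_row i : (0 < i <= n)%N -> exists2 row, row \in T & i \in row.
Proof.
move=> ib; apply/flattenP; case: standard_facts => _ _ /perm_mem-> _ _.
by rewrite mem_iota add1n ltnS.
Qed.

Lemma standard_row_neq0 row : row \in T -> row != [::].
Proof.
by case: standard_facts => _ /allP ge1 _ _ _ rT; have := ge1 _ (map_f size rT); case: row {rT}.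
Qed.

Lemma column_of_nth row c : row \in T -> (c < size row)%N ->
  column_of T (nth 0%N row c) = c.
Proof.
move=> rT cr; rewrite (column_of_mem standard_uniq rT) ?mem_nth // index_uniq //.
apply: sorted_uniq ltn_trans ltnn _ _.
by case: standard_facts => _ _ _ /allP/(_ _ rT).
Qed.

(** Reads delta off the columns of the entries above r. *)
Lemma column_max_gt r c : (r < column_max T c)%N =
  (c \in [seq column_of T i | i <- iota r.+1 (n - r)]).
Proof.
apply/idP/mapP => [|[i]].
  rewrite ltnNge => /negP max_gt.
  have [row rT gt] : exists2 row, row \in T & (r < nth 0%N row c)%N.
    apply/hasP; apply/negPn/negP => /hasPn none; apply: max_gt.
    by apply/bigmax_leqP_seq => row rT _; rewrite leqNgt none.
  have cr : (c < size row)%N.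
    by rewrite ltnNge; apply/negP => rc; move: gt; rewrite nth_default.
  exists (nth 0%N row c); last by rewrite column_of_nth.
  have := standard_entry rT (mem_nth 0%N cr); rewrite mem_iota; move: gt.
  by move: (nth 0%N row c) => i; lia.
rewrite mem_iota => ib ->; have [|row rT ir] := @standard_row i; first lia.
rewrite (column_of_mem standard_uniq rT ir).
have le : (nth 0%N row (index i row) <= column_max T (index i row))%N.
  by move: (index i row) => j; apply: (@leq_bigmax_seq _ T xpredT (fun row => nth 0%N row j)).
by apply: leq_trans _ le; rewrite nth_index //; lia.
Qed.

Lemma standard_row_size row : row \in T -> (size row <= n)%N.
Proof.
move=> rT; rewrite -(size_iota 1 n); apply: uniq_leq_size.
  apply: sorted_uniq ltn_trans ltnn _ _.
  by case: standard_facts => _ _ _ /allP/(_ _ rT).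
by move=> i ir; have := standard_entry rT ir; rewrite mem_iota; lia.
Qed.

Lemma column_max_last : column_max T n = 0%N.
Proof.
apply/eqP; rewrite -leqn0; apply/bigmax_leqP_seq => row rT _.
by rewrite nth_default // standard_row_size.
Qed.

Section AddBox.
Variables (r c : nat).
Hypothesis c_max : (column_max T c <= r)%N.
Hypothesis c_prev : (c == 0%N) || (r < column_max T c.-1)%N.

Let h := column_height T c.
Let row := nth [::] T h.

(** If the row below column c were shorter than c, the columns c-1 and c would
    have the same height, and the largest entry of column c would exceed that of
    column c-1. *)
Lemma add_row_size : size row = c.
Proof.
have [srt _ _ rows _] := standard_facts.
apply/eqP; rewrite eqn_leq; apply/andP; split.
  by rewrite leqNgt -height_ltE // ltnn.
case/orP: c_prev => [/eqP->//|gt]; rewrite leqNgt; apply/negP => small.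
have c0 : (0 < c)%N by lia.
move: gt; apply/negP; rewrite -leqNgt; apply: leq_trans c_max.
apply/bigmax_leqP_seq => row' rT _.
case: (ltnP c.-1 (size row')) => cr; last by rewrite nth_default.
have cr' : (c < size row')%N.
  rewrite -(nth_index [::] rT) -height_ltE // -/h ltnNge; apply/negP => hi.
  have := @height_ltE T c.-1 (index row' T) srt; rewrite nth_index // cr.
  have := @height_ltE T c.-1 h srt; rewrite -/row.
  by lia.
apply: leq_trans (_ : nth 0%N row' c <= _)%N; last first.
  exact: (@leq_bigmax_seq _ T xpredT (fun row => nth 0%N row c) row' rT isT).
have srt' := allP rows _ rT.
by rewrite ltnW // (sorted_ltn_nth ltn_trans) // ?inE ?prednK //; lia.
Qed.

Let T' := add_bottom T c n.+1.

(** The list A ++ row :: D is T, or T with an empty last row when the box starts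
    a new row; this treats both cases together. *)
Lemma add_bottom_split : exists A D,
  [/\ T' = A ++ rcons row n.+1 :: D,
      T = [seq w <- A ++ row :: D | w != [::]],
      A ++ row :: D = T \/ A ++ row :: D = rcons T [::],
      all (fun w => c < size w)%N A & all (fun w => w != [::]) D].
Proof.
have hT : (h <= size T)%N by apply: count_size.
have T'E : T' = set_nth [::] T h (rcons row n.+1).
  rewrite /T' /add_bottom /put -/h -/row; congr (set_nth _ _ _ _).
  by rewrite set_nthE add_row_size ltnn subnn cats1.
have [srt _ _ _ _] := standard_facts.
have A_big : all (fun w => c < size w)%N (take h T).
  apply/(all_nthP [::]) => i; rewrite size_take_min => ih.
  by rewrite nth_take -?height_ltE //; lia.
have T_id : [seq w <- T | w != [::]] = T.
  by apply/all_filterP/allP => w; apply: standard_row_neq0.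
exists (take h T), (drop h.+1 T); rewrite T'E set_nthE.
case: ltnP => hh; split => //.
- by rewrite -drop_nth // cat_take_drop T_id.
- by left; rewrite -drop_nth // cat_take_drop.
- by apply/allP => w /mem_drop; apply: standard_row_neq0.
- have -> : h = size T by lia.
  by rewrite subnn take_size drop_oversize.
- rewrite /row nth_default // take_oversize // drop_oversize ?(leqW hh) //.
  by rewrite filter_cat /= cats0 T_id.
- right; rewrite /row nth_default // take_oversize // drop_oversize ?(leqW hh) //.
  by rewrite cats1.
- by rewrite drop_oversize ?(leqW hh).
Qed.

Lemma add_bottom_perm : perm_eq (flatten T') (n.+1 :: flatten T).
Proof.
have [A [D [-> TE _ _ _]]] := add_bottom_split.
have -> : flatten T = flatten (A ++ row :: D).
  rewrite TE; elim: (A ++ row :: D) => //= -[|x w] W /= -> //.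
apply/seq.permP => p; rewrite /= !flatten_cat /= -cats1 !count_cat /=; lia.
Qed.

Lemma add_bottom_standard : standard n.+1 T'.
Proof.
have [srt ge1 permT rows cols] := standard_facts.
have perm' : perm_eq (flatten T') (iota 1 n.+1).
  rewrite (perm_trans add_bottom_perm) //.
  rewrite -[n.+1]addn1 iotaD /= add1n addn1 perm_sym perm_catC /= perm_cons.
  by rewrite perm_sym.
have [A [D [T'E TE T0 A_big D_neq0]]] := add_bottom_split.
have in_T0 w : w \in A ++ row :: D -> (w \in T) \/ w = [::].
  case: T0 => ->; first by left.
  by rewrite mem_rcons inE => /orP[/eqP|]; [right|left].
have srt0 : sorted [rel a b | (size b <= size a)%N && all (fun xy => xy.1 < xy.2)%N (zip a b)]
    (A ++ row :: D).
  rewrite (sorted_relI (fun a b => size b <= size a)%N).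
  have srt1 : sorted (fun a b => size b <= size a)%N T.
    by move: srt; rewrite /shape sorted_map.
  case: T0 => ->; first by rewrite srt1 cols.
  rewrite -!cats1; case: (T) srt1 cols => //= t T1.
  by rewrite !cat_path /= => -> ->; case: (last _ _).
have x_big w i : w \in A ++ row :: D -> i \in w -> (i < n.+1)%N.
  by case/in_T0 => [wT iw|->//]; case/andP: (standard_entry wT iw).
have := add_row_size => row_c.
have srt0' :
  sorted [rel a b | (size b <= size a)%N && all (fun xy => xy.1 < xy.2)%N (zip a b)] T'.
  rewrite T'E; apply: sorted_replace srt0 => /= [b bA /andP[le zb]|b /andP[le zb]].
    have lt := allP A_big _ bA.
    rewrite zip_rcons_long ?row_c // all_rcons zb size_rcons row_c lt /= andbT.
    by apply: (x_big b); rewrite ?mem_cat ?bA // mem_nth.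
  by rewrite zip_rcons_short // size_rcons zb leqW.
rewrite (sorted_relI (fun a b => size b <= size a)%N) in srt0'.
case/andP: srt0' => srt' cols'.
rewrite /standard perm' cols' /is_partition /shape sorted_map srt' !andbT /=.
have -> : sumn (map size T') == n.+1.
  by rewrite -size_flatten (perm_size perm') size_iota.
rewrite andbT T'E; apply/andP; split.
  rewrite all_map all_cat /= size_rcons /=; apply/andP; split.
    by apply: sub_all A_big => w; apply: leq_ltn_trans.
  by apply: sub_all D_neq0 => w; rewrite /= lt0n size_eq0.
have sorted0 w : w \in A ++ row :: D -> sorted ltn w.
  by case/in_T0 => [/(allP rows)|->].
apply/allP => w; rewrite mem_cat inE => /or3P[wA|/eqP->|wD].
- by apply: sorted0; rewrite mem_cat wA.
- have := sorted0 row; have := x_big row; rewrite mem_cat inE eqxx orbT.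
  case: (row) => //= i s big srt_s; rewrite rcons_path srt_s //=.
  by apply: big; rewrite ?mem_last.
- by apply: sorted0; rewrite mem_cat inE wD !orbT.
Qed.

Lemma add_bottom_column i : (0 < i <= n)%N -> column_of T' i = column_of T i.
Proof.
move=> ib; have [w wT iw] := standard_row ib.
have uT' := standard_uniqE add_bottom_standard.
have [A [D [T'E TE T0 A_big D_neq0]]] := add_bottom_split.
rewrite (column_of_mem standard_uniq wT iw).
have : w \in A ++ row :: D by move: wT; rewrite {1}TE mem_filter => /andP[].
rewrite mem_cat inE => /or3P[wA|/eqP wE|wD].
- by rewrite (column_of_mem uT' _ iw) // T'E mem_cat wA.
- rewrite (column_of_mem uT' (row := rcons row n.+1)).
  + by rewrite -cats1 index_cat -wE iw.
  + by rewrite T'E mem_cat mem_head orbT.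
  + by rewrite mem_rcons inE -wE iw orbT.
- by rewrite (column_of_mem uT' _ iw) // T'E mem_cat inE wD !orbT.
Qed.

Lemma big_not_in w : w \in T -> n.+1 \notin w.
Proof. by move=> wT; apply/negP => /(standard_entry wT); rewrite ltnn. Qed.

Lemma row_not_in : n.+1 \notin row.
Proof.
rewrite /row; case: (ltnP h (size T)) => hT; last by rewrite nth_default.
by apply: big_not_in; apply: mem_nth.
Qed.

Lemma add_bottom_new_column : column_of T' n.+1 = c.
Proof.
have uT' := standard_uniqE add_bottom_standard.
have [A [D [T'E _ _ _ _]]] := add_bottom_split.
rewrite (column_of_mem uT' (row := rcons row n.+1)).
- by rewrite -cats1 index_cat (negPf row_not_in) /= eqxx addn0 add_row_size.
- by rewrite T'E mem_cat mem_head orbT.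
- by rewrite mem_rcons mem_head.
Qed.

Lemma add_bottom_erase : erase T' n.+1 = T.
Proof.
have [A [D [T'E TE T0 _ _]]] := add_bottom_split.
have rem_T0 w : w \in A ++ row :: D -> rem n.+1 w = w.
  move=> wT0; apply: rem_id; case: T0 wT0 => -> .
    exact: big_not_in.
  by rewrite mem_rcons inE => /orP[/eqP->//|]; apply: big_not_in.
rewrite /erase T'E [RHS]TE map_cat /= rem_rcons ?row_not_in //; congr filter.
congr (_ ++ _ :: _); rewrite -[RHS]map_id; apply/eq_in_map => w wA; apply: rem_T0.
  by rewrite mem_cat wA.
by rewrite mem_cat inE wA !orbT.
Qed.

Lemma add_bottom_shape (K : comPzRingType) (G : nat -> K) :
  \prod_(w <- T') \prod_(0 <= i < size w) G i =
  (\prod_(w <- T) \prod_(0 <= i < size w) G i) * G c.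
Proof.
have [A [D [-> TE _ _ _]]] := add_bottom_split.
have drop_nil (W : tableau) : \prod_(w <- W | w != [::]) \prod_(0 <= i < size w) G i =
    \prod_(w <- W) \prod_(0 <= i < size w) G i.
  rewrite big_mkcond; apply: eq_bigr => w _.
  by case: (eqVneq w [::]) => [->|] //=; rewrite big_geq.
rewrite {1}TE big_filter drop_nil.
rewrite !big_cat !big_cons /= size_rcons big_nat_recr //= add_row_size.
by ring.
Qed.
End AddBox.
End Standard.

(** * The tableaux of nonzero probability *)

Lemma falls_uniq x o s : uniq (falls x o s).
Proof. exact: (sorted_uniq ltn_trans ltnn (falls_sorted x o s).1). Qed.

Lemma mem_falls_delta n r T c : (c \in falls true 0 (delta n r T)) =
  [&& (c <= n)%N, (column_max T c <= r)%N & (c == 0%N) || (r < column_max T c.-1)%N].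
Proof.
rewrite mem_falls size_map size_iota subn0 /= add0n ltnS.
case: (leqP c n) => //= cn.
have nthE i : (i <= n)%N -> nth false (delta n r T) i = (r < column_max T i)%N.
  by move=> i_n; rewrite (nth_map 0%N) ?size_iota // nth_iota.
rewrite nthE // -leqNgt; congr andb; case: eqP => //= c0.
by rewrite nthE //; lia.
Qed.

(** Generates the tableaux of nonzero probability recursively, each of them once. *)
Fixpoint hikita_tableaux (m : nat -> nat) (n : nat) : seq tableau :=
  if n is n'.+1 then
    [seq add_bottom U c n'.+1 | U <- hikita_tableaux m n',
                                c <- falls true 0 (delta n' (m n'.+1) U)]
  else [:: [::]].

Lemma hikita_tableauxS m n : hikita_tableaux m n.+1 =
  [seq add_bottom U c n.+1 | U <- hikita_tableaux m n,
                             c <- falls true 0 (delta n (m n.+1) U)].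
Proof. by []. Qed.

Lemma hikita_tableauxSP m n T :
  reflect (exists S c, [/\ S \in hikita_tableaux m n, (c <= n)%N,
     (column_max S c <= m n.+1)%N,
     (c == 0%N) || (m n.+1 < column_max S c.-1)%N & T = add_bottom S c n.+1])
   (T \in hikita_tableaux m n.+1).
Proof.
apply: (iffP allpairsPdep) => -[S [c]].
  by case=> hS; rewrite mem_falls_delta => /and3P[]; exists S, c.
by case=> hS cn cm cp ->; exists S, c; rewrite mem_falls_delta cn cm cp.
Qed.

Lemma hikita_tableaux_standard m n T : T \in hikita_tableaux m n -> standard n T.
Proof.
elim: n T => [|n IHn] T; first by rewrite inE => /eqP->.
case/hikita_tableauxSP => S [c [/IHn stS _ cm cp ->]].
exact: (add_bottom_standard stS cm cp).
Qed.

Lemma hikita_tableaux_uniq m n : uniq (hikita_tableaux m n).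
Proof.
elim: n => [//|n IHn]; rewrite hikita_tableauxS; apply: allpairs_uniq_dep => //.
  by move=> S _; exact (falls_uniq _ _ _).
move=> /= [S c] [S' c'] /allpairsPdep[S1 [c1 [hS1 hc1 [-> ->]]]].
move=> /allpairsPdep[S2 [c2 [hS2 hc2 [-> ->]]]] /= e.
move: hc1 hc2; rewrite !mem_falls_delta => /and3P[_ cm1 cp1] /and3P[_ cm2 cp2].
have st1 := hikita_tableaux_standard hS1; have st2 := hikita_tableaux_standard hS2.
have eS : S1 = S2.
  by rewrite -(add_bottom_erase st1 cm1 cp1) e (add_bottom_erase st2 cm2 cp2).
have ec : c1 = c2.
  by rewrite -(add_bottom_new_column st1 cm1 cp1) e (add_bottom_new_column st2 cm2 cp2).
by rewrite eS ec.
Qed.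

Lemma hikita_columns_standard n r S : standard n S ->
  [seq hikita_column n r S k | k <- iota 0 (blk_len n r S).+1] =
    falls true 0 (delta n r S).
Proof. by move=> st; apply: hikita_columns; apply: (column_max_last st). Qed.

Lemma hikita_tableaux_prob m n T :
  T \in hikita_tableaux m n -> hikita_prob m n T != 0.
Proof.
elim: n T => [|n IHn] T; first by rewrite oner_neq0.
case/hikita_tableauxSP => S [c [hS cn cm cp ->]] /=.
have st := hikita_tableaux_standard hS.
rewrite (add_bottom_erase st cm cp).
have : c \in falls true 0 (delta n (m n.+1) S) by rewrite mem_falls_delta cn cm cp.
rewrite -(hikita_columns_standard _ st) => /mapP[k]; rewrite mem_iota => /= kl ck.
case: pickP => [k' _|none].
  by rewrite mulf_neq0 ?IHn // hikita_phi_neq0 // -ltnS.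
by have /eqP[] := negbT (none (Ordinal kl)); rewrite ck.
Qed.

Lemma iota1S n : iota 1 n.+1 = iota 1 n ++ [:: n.+1].
Proof. by rewrite -(addn1 n) iotaD add1n addn1. Qed.

Lemma uniq_flatten_row (T : tableau) w : uniq (flatten T) -> w \in T -> uniq w.
Proof.
elim: T => //= u T IHT; rewrite cat_uniq inE => /and3P[uu _ uT].
by case/orP => [/eqP->|/(IHT uT)].
Qed.

Lemma flatten_nonempty (T : tableau) : flatten [seq w <- T | w != [::]] = flatten T.
Proof. by elim: T => //= w T IHT; case: (eqVneq w [::]) => [->|_] /=; rewrite IHT. Qed.

(** Erasing the largest entry preserves the two properties of T assumed here;
    that T is standard then results from the way in which it is rebuilt. *)
Lemma hikita_prob_tableaux m n T :
    all (fun w => w != [::]) T -> perm_eq (flatten T) (iota 1 n) ->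
  hikita_prob m n T != 0 -> T \in hikita_tableaux m n.
Proof.
elim: n T => [|n IHn] T nonempty permT.
  have : flatten T == [::] by rewrite -size_eq0 (perm_size permT).
  by case: T nonempty {permT} => //= -[|x w] T.
have uT : uniq (flatten T) by rewrite (perm_uniq permT) iota_uniq.
rewrite /=; case: pickP => [k /eqP Tk|_]; last by rewrite eqxx.
set S := erase T n.+1 in k Tk *.
rewrite mulf_eq0 negb_or => /andP[_ probS].
have hS : S \in hikita_tableaux m n.
  apply: IHn => //; first by apply/allP => w; rewrite mem_filter => /andP[].
  rewrite /S /erase flatten_nonempty.
  have -> : [seq rem n.+1 w | w <- T] = [seq [seq y <- w | predC1 n.+1 y] | w <- T].
    apply/eq_in_map => w wT; apply: rem_filter.
    exact: (uniq_flatten_row uT wT).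
  rewrite -filter_flatten (perm_trans (perm_filter _ permT)) //.
  rewrite iota1S filter_cat /= eqxx cats0.
  rewrite (_ : filter _ _ = iota 1 n) //; apply/all_filterP/allP => i.
  by rewrite mem_iota /=; lia.
apply/hikita_tableauxSP; exists S, (hikita_column n (m n.+1) S k).
have st := hikita_tableaux_standard hS.
have : hikita_column n (m n.+1) S k \in falls true 0 (delta n (m n.+1) S).
  by rewrite -(hikita_columns_standard _ st) map_f // mem_iota add0n ltn_ord.
by rewrite mem_falls_delta => /and3P[? ? ?]; split=> //; rewrite -Tk.
Qed.

Lemma HikSYT_E n m lam :
  HikSYT n m lam = [set` [seq T <- hikita_tableaux m n | shape T == lam]]%classic.
Proof.
apply/seteqP; split=> T /=.
  case=> st shT prob; rewrite mem_filter shT eqxx /=.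
  apply: hikita_prob_tableaux => //; first by apply/allP => w; exact: (standard_row_neq0 st).
  by case/and4P: st.
rewrite mem_filter => /andP[/eqP shT hT]; split=> //.
  exact: (hikita_tableaux_standard hT).
exact: hikita_tableaux_prob.
Qed.

Definition columns (n : nat) (T : tableau) : seq nat :=
  [seq column_of T i | i <- iota 1 n].

Lemma size_columns n T : size (columns n T) = n.
Proof. by rewrite size_map size_iota. Qed.

Lemma columns_add_bottom n T c r : standard n T ->
    (column_max T c <= r)%N -> (c == 0%N) || (r < column_max T c.-1)%N ->
  columns n.+1 (add_bottom T c n.+1) = rcons (columns n T) c.
Proof.
move=> st cm cp; rewrite /columns iota1S map_cat cats1.
rewrite (add_bottom_new_column st cm cp); congr rcons; apply/eq_in_map => i.
by rewrite mem_iota => ib; apply: (add_bottom_column st cm cp); lia.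
Qed.

Lemma mem_falls_columns n r T c : standard n T ->
  (c \in falls true 0 (delta n r T)) =
  [&& (c <= n)%N, c \notin drop r (columns n T) & active (drop r (columns n T)) c].
Proof.
move=> st; rewrite mem_falls_delta [(column_max T c <= r)%N]leqNgt /active.
by rewrite !(column_max_gt st) /columns -map_drop drop_iota add1n.
Qed.

Section Weights.
Variables (K : fieldType) (q : K) (G : nat -> K) (m : nat -> nat).
Let mu k := m k.+1.

(** A tableau enters the sum through the word of the columns of its entries. *)
Definition word_weight (n : nat) (s : seq nat) : K :=
  \prod_(0 <= k < n) column_weight q G (drop (mu k) (take k s)) (nth 0%N s k).

Lemma word_weight_rcons n s c : size s = n ->
  word_weight n.+1 (rcons s c) = word_weight n s * column_weight q G (drop (mu n) s) c.
Proof.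
move=> sn; rewrite /word_weight big_nat_recr //=; congr (_ * _).
  apply: eq_big_nat => k /andP[_ kn].
  by rewrite nth_rcons sn kn -cats1 takel_cat // sn ltnW.
by rewrite nth_rcons sn ltnn eqxx -cats1 takel_cat ?sn // -sn take_size.
Qed.

(** A word of columns has a nonzero weight only if it adds every box at a fall,
    that is, in a column that is not marked and follows a marked one or none. *)
Lemma hikita_tableaux_Zrec B n Phi : (n <= B)%N ->
  Zrec (fun (M : seq 'I_B) c => column_weight q G (map val M) (val c)) mu n
      (fun s => Phi (map val s)) =
    \sum_(T <- hikita_tableaux m n) word_weight n (columns n T) * Phi (columns n T).
Proof.
elim: n Phi => [|n IHn] Phi nB.
  by rewrite /= big_seq1 /word_weight big_geq // mul1r.
pose Psi (s : seq nat) :=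
  \sum_(0 <= c < B) column_weight q G (drop (mu n) s) c * Phi (rcons s c).
transitivity (Zrec (fun (M : seq 'I_B) c => column_weight q G (map val M) (val c)) mu n
   (fun s => Psi (map val s))).
  rewrite /=; apply: eq_Zrec => s _; rewrite /Psi big_mkord; apply: eq_bigr => c _.
  by rewrite map_drop map_rcons.
rewrite IHn ?(ltnW nB) // hikita_tableauxS big_allpairs_dep big_seq [RHS]big_seq.
apply: eq_bigr => T hT; have st := hikita_tableaux_standard hT.
rewrite /Psi mulr_sumr.
pose F c := word_weight n (columns n T) *
  (column_weight q G (drop (mu n) (columns n T)) c * Phi (rcons (columns n T) c)).
transitivity (\sum_(c <- falls true 0 (delta n (m n.+1) T)) F c); last first.
  rewrite big_seq [RHS]big_seq; apply: eq_bigr => c.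
  rewrite mem_falls_delta => /and3P[_ cm cp].
  rewrite (columns_add_bottom st cm cp) word_weight_rcons ?size_columns //.
  by rewrite /F mulrA.
have perm : perm_eq [seq c <- iota 0 B | c \in falls true 0 (delta n (m n.+1) T)]
    (falls true 0 (delta n (m n.+1) T)).
  apply: uniq_perm; rewrite ?filter_uniq ?iota_uniq //.
    exact: falls_uniq.
  move=> c; rewrite mem_filter mem_iota andb_idr // mem_falls_delta.
  by case/and3P=> cn _ _; lia.
rewrite -(perm_big _ perm) big_filter [RHS]big_mkcond /= /index_iota subn0.
apply: eq_bigr => c _; case: ifP => // /negbT.
rewrite (mem_falls_columns _ _ st) !negb_and -/(mu n) negbK /F.
set M := drop _ _; case/or3P => [cn|cM|cM].
- rewrite /column_weight (_ : active M c = false) ?(mulr0, mul0r) //.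
  apply/negbTE; rewrite /active negb_or; apply/andP; split; first lia.
  apply/negP => /mem_drop /mapP[i]; rewrite mem_iota => ib.
  have [|row rT ir] := standard_row st (i := i); first lia.
  rewrite (column_of_mem (standard_uniqE st) rT ir) => ci.
  have : (index i row < size row)%N by rewrite index_mem.
  have := standard_row_size st rT; lia.
- by rewrite column_weight_mem ?mul0r ?mulr0.
- by rewrite /column_weight (negPf cM) ?(mulr0, mul0r).
Qed.
End Weights.

(** * The functions h_T *)

Lemma hess_reverse n m : reverse_hessenberg n m -> hess n (fun k => m k.+1).
Proof. by case=> lt mono; split=> k kn; [rewrite -ltnS; apply: lt|apply: mono]; lia. Qed.

(** The columns of the entries above m (k+1) among the first k entries, which are
    those incomparable to the entry k+1. *)
Definition marks (m : nat -> nat) (n : nat) (T : tableau) (k : nat) : seq nat :=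
  drop (m k.+1) (take k (columns n T)).

Definition column_at (n : nat) (T : tableau) (k : nat) : nat :=
  nth 0%N (columns n T) k.

Lemma hikita_tableaux_prefix m n T k : T \in hikita_tableaux m n -> (k <= n)%N ->
  exists2 S, S \in hikita_tableaux m k & take k (columns n T) = columns k S.
Proof.
elim: n T => [|n IHn] T hT; first by rewrite leqn0 => /eqP->; exists T.
rewrite leq_eqVlt => /orP[/eqP->|]; first by exists T; rewrite // take_oversize ?size_columns.
rewrite ltnS => kn; case/hikita_tableauxSP: hT => S [c [hS _ cm cp ->]].
have [S' hS' e] := IHn S hS kn; exists S' => //.
rewrite (columns_add_bottom (hikita_tableaux_standard hS) cm cp) -cats1.
by rewrite takel_cat ?size_columns.
Qed.

Lemma hikita_tableaux_step m n T k : T \in hikita_tableaux m n -> (k < n)%N ->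
  exists S, [/\ S \in hikita_tableaux m k, take k (columns n T) = columns k S &
    column_at n T k \in falls true 0 (delta k (m k.+1) S)].
Proof.
move=> hT kn; have [S' /hikita_tableauxSP[S [c [hS cn cm cp ->]]]] :=
  hikita_tableaux_prefix hT kn.
rewrite (columns_add_bottom (hikita_tableaux_standard hS) cm cp) => e.
exists S; split=> //.
  have := congr1 (take k) e; rewrite -cats1 takel_cat ?size_columns //.
  by rewrite (take_oversize (s := columns k S)) ?size_columns // take_takel.
rewrite /column_at -(nth_take _ (ltnSn k)) e nth_rcons size_columns ltnn eqxx.
by rewrite mem_falls_delta cn cm cp.
Qed.

Lemma hikita_tableaux_marks m n T k : T \in hikita_tableaux m n -> (k < n)%N ->
  (column_at n T k \notin marks m n T k) && active (marks m n T k) (column_at n T k).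
Proof.
move=> hT kn; have [S [hS e]] := hikita_tableaux_step hT kn.
rewrite /marks e (mem_falls_columns _ _ (hikita_tableaux_standard hS)).
by case/and3P=> _ -> ->.
Qed.

(** A box is added only below entries up to m (k+1), so that a column contains at
    most one entry above this value. *)
Lemma uniq_drop_columns m n T r : hess n (fun k => m k.+1) ->
    T \in hikita_tableaux m n -> (n = 0 \/ m n <= r)%N ->
  uniq (drop r (columns n T)).
Proof.
elim: n T r => [//|n IHn] T r hm hT [//|mr].
case/hikita_tableauxSP: hT => S [c [hS cn cm cp ->]].
have st := hikita_tableaux_standard hS.
rewrite (columns_add_bottom st cm cp).
have hm' : hess n (fun k => m k.+1).
  by split=> k kn; [apply: hm.1|apply: hm.2]; lia.
case: (leqP r n) => rn; last by rewrite drop_oversize // size_rcons size_columns.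
rewrite -cats1 drop_cat size_columns; case: ltnP => rn'; last by case: (_ - _)%N.
rewrite cats1 rcons_uniq; apply/andP; split.
  have : c \in falls true 0 (delta n (m n.+1) S) by rewrite mem_falls_delta cn cm cp.
  rewrite (mem_falls_columns _ _ st) => /and3P[_ cM _].
  by apply: contra cM; rewrite -(subnK mr) -drop_drop; apply: mem_drop.
apply: IHn => //; case: n {S hS cn cm cp st hm' rn rn'} hm mr => [|n] hm mr; first by left.
by right; apply: leq_trans mr; apply: hm.2.
Qed.

Lemma hikita_tableaux_uniq_marks m n T k : hess n (fun k => m k.+1) ->
  T \in hikita_tableaux m n -> (k < n)%N -> uniq (marks m n T k).
Proof.
move=> hm hT kn; have [S [hS e _]] := hikita_tableaux_step hT kn.
rewrite /marks e; apply: uniq_drop_columns hS _.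
  by split=> i ik; [apply: hm.1|apply: hm.2]; lia.
by case: k kn {S e} => [|k] kn; [left|right; apply: hm.2].
Qed.

(** The factor of a mark p next to the box in column c is a ratio of two
    q-integers, or 1 if p = c-1; the value 1 stands for [1] = 1. *)
Definition mark_num (c p : nat) : nat :=
  (if p.+1 < c then c - p else if c < p then p - c else 1)%N.

Definition mark_den (c p : nat) : nat :=
  (if p.+1 < c then c - p.+1 else if c < p then p.+1 - c else 1)%N.

Definition step_num (M : seq nat) (c : nat) : seq nat := map (mark_num c) M.

Definition step_den (M : seq nat) (c : nat) : seq nat :=
  maxn c 1 :: map (mark_den c) M.

Lemma mark_num_gt0 c p : (0 < mark_num c p)%N.
Proof. by rewrite /mark_num; case: ifP => [|_]; [|case: ifP]; lia. Qed.

Lemma mark_den_gt0 c p : (0 < mark_den c p)%N.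
Proof. by rewrite /mark_den; case: ifP => [|_]; [|case: ifP]; lia. Qed.

Lemma step_num_gt0 M c : all (leq 1) (step_num M c).
Proof. by rewrite all_map; apply/allP => p _; apply: mark_num_gt0. Qed.

Lemma step_den_gt0 M c : all (leq 1) (step_den M c).
Proof.
by rewrite /= leq_maxr all_map; apply/allP => p _; apply: mark_den_gt0.
Qed.

Lemma all_flatten_map (I : Type) (F : I -> seq nat) (s : seq I) :
  (forall i, all (leq 1) (F i)) -> all (leq 1) (flatten (map F s)).
Proof. by move=> hF; elim: s => //= i s IHs; rewrite all_cat hF. Qed.

(** The function h_T.  Each entry contributes one step, and the powers of q are
    left out: they add up to the number of inversions. *)
Definition tableau_quotient (m : nat -> nat) (n : nat) (T : tableau) : qquot :=
  QQuot
    (all_flatten_map (iota 0 n) (fun k => step_num_gt0 (marks m n T k) (column_at n T k)))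
    (all_flatten_map (iota 0 n) (fun k => step_den_gt0 (marks m n T k) (column_at n T k))).

Definition step_eval (K : fieldType) (q : K) (M : seq nat) (c : nat) : K :=
  (\prod_(k <- step_num M c) qint q k) / (\prod_(k <- step_den M c) qint q k).

Lemma tableau_quotient_eval (K : fieldType) (q : K) m n T :
  qquot_eval (tableau_quotient m n T) q =
    \prod_(0 <= k < n) step_eval q (marks m n T k) (column_at n T k).
Proof.
rewrite /qquot_eval /= !big_flatten !big_map /index_iota subn0 -prodf_div.
by apply: eq_bigr.
Qed.

Section StepWeight.
Variables (K : fieldType) (q : K) (G : nat -> K).
Hypothesis qint_neq0 : forall k, qint q k.+1 != 0.
Hypothesis q_neq0 : q != 0.
Hypothesis q_neq1 : q != 1.

Lemma column_factor_mark c p : p != c ->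
  column_factor q c p = q ^+ (c < p)%N * (qint q (mark_num c p) / qint q (mark_den c p)).
Proof.
rewrite /mark_num /mark_den; case: ltngtP => // pc _.
  have -> : (p.+1 < c)%N = false by lia.
  by rewrite column_factor_above // expr1.
rewrite mul1r; case: ltnP => pc1; first by rewrite column_factor_below.
have -> : c = p.+1 by lia.
by rewrite /column_factor eqxx qint1 divr1.
Qed.

Lemma column_weight_step M c : c \notin M -> active M c ->
  column_weight q G M c = G c * (q ^+ count (fun p => c < p)%N M * step_eval q M c).
Proof.
move=> cM acM; rewrite /column_weight acM mulr1 -mulrA; congr (_ * _).
rewrite big_seq (eq_bigr (fun p => q ^+ (c < p)%N *
    (qint q (mark_num c p) / qint q (mark_den c p)))) => [|p pM]; last first.
  by apply: column_factor_mark; apply: contraNneq cM => <-.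
rewrite -big_seq big_split /= prodf_div /step_eval big_cons !big_map invfM.
have -> : \prod_(p <- M) q ^+ (c < p)%N = q ^+ count (fun p => c < p)%N M.
  by elim: (M) => [|p M' IHM]; rewrite ?big_nil ?big_cons //= IHM -exprD.
have -> : column_base q c = (qint q (maxn c 1))^-1.
  by case: c {cM acM} => [|c]; rewrite /= ?qint1 ?invr1 // (maxn_idPl _).
ring.
Qed.
End StepWeight.

Section Bound.
Variables (R : realType) (tau : R).
Hypothesis tau_ge0 : 0 <= tau.

Lemma qint_gt0 k : (0 < k)%N -> 0 < qint tau k.
Proof.
case: k => // k _; rewrite /qint big_ord_recl expr0 ltr_wpDr // sumr_ge0 // => i _.
exact: exprn_ge0.
Qed.

Lemma qint_le i j : (i <= j)%N -> qint tau i <= qint tau j.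
Proof.
move=> /subnK <-; elim: (j - i)%N => // k IHk; rewrite addSn qintS.
by rewrite (le_trans IHk) // lerDl exprn_ge0.
Qed.

(** The factors of the marks p > c are at most 1.  Those of the marks p < c-1 are
    at least 1, so their product increases when all p < c-1 are taken, and then
    it telescopes to [c], which is the denominator left. *)
Lemma step_eval_bound M c : uniq M -> c \notin M -> 0 < step_eval tau M c <= 1.
Proof.
move=> uM cM.
have ratio_gt0 p : 0 < qint tau (mark_num c p) / qint tau (mark_den c p).
  by rewrite divr_gt0 ?qint_gt0 ?mark_num_gt0 ?mark_den_gt0.
rewrite /step_eval big_cons !big_map invfM mulrCA -prodf_div.
set P := \prod_(p <- M) _.
have P_gt0 : 0 < P by apply: prodr_gt0 => p _.
have c_gt0 : 0 < qint tau (maxn c 1) by rewrite qint_gt0 // leq_max orbT.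
apply/andP; split; first by rewrite mulr_gt0 ?invr_gt0.
rewrite mulrC ler_pdivrMr // mul1r.
pose g p := qint tau (c - p) / qint tau (c - p.+1).
have P1E : \prod_(p <- M | (p.+1 < c)%N) (qint tau (mark_num c p) / qint tau (mark_den c p))
    = \prod_(p <- M | (p.+1 < c)%N) g p.
  by apply: eq_bigr => p pc; rewrite /mark_num /mark_den pc.
have P1_gt0 : 0 < \prod_(p <- M | (p.+1 < c)%N) g p.
  by rewrite -P1E prodr_gt0.
have P2_le1 : \prod_(p <- M | ~~ (p.+1 < c)%N)
    (qint tau (mark_num c p) / qint tau (mark_den c p)) <= 1.
  apply: prodr_ile1 => p pc.
  rewrite ltW //= ler_pdivrMr ?qint_gt0 ?mark_den_gt0 // mul1r qint_le //.
  by rewrite /mark_num /mark_den (negPf pc); case: ifP; lia.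
rewrite /P (bigID (fun p => p.+1 < c)%N) /= P1E.
apply: (le_trans (ler_piMr (ltW P1_gt0) P2_le1)).
case: c cM @g P1_gt0 {P P_gt0 c_gt0 ratio_gt0 P1E P2_le1} => [|c] cM g P1_gt0.
  by rewrite big_pred0 ?qint1.
have telescoped : \prod_(p <- iota 0 c) g p = qint tau c.+1.
  rewrite telescope_below // => [|k]; last by rewrite gt_eqF ?qint_gt0.
  by rewrite subSnn qint1 divr1.
rewrite (maxn_idPl _) // -telescoped (bigID (fun p => p \in M) xpredT) /=.
have -> : \prod_(p <- iota 0 c | p \in M) g p = \prod_(p <- M | (p.+1 < c.+1)%N) g p.
  rewrite -big_filter -[RHS]big_filter; apply: perm_big; apply: uniq_perm.
  - by rewrite filter_uniq ?iota_uniq.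
  - by rewrite filter_uniq.
  by move=> p; rewrite !mem_filter mem_iota add0n ltnS andbC.
have ge1 : \prod_(p <- iota 0 c | p \notin M) (1 : R) <=
    \prod_(p <- iota 0 c | p \notin M) g p.
  rewrite big_seq_cond [X in _ <= X]big_seq_cond.
  apply: ler_prod => p /andP[]; rewrite mem_iota add0n => pc _.
  by rewrite ler01 /= ler_pdivlMr ?qint_gt0 ?mul1r ?qint_le //; lia.
by rewrite ler_peMr ?(ltW P1_gt0) // (le_trans _ ge1) // big1.
Qed.
End Bound.

(** * The expansion over a field *)

(** For i < k the vertex k cannot lie below i, since m (i+1) <= i. *)
Lemma inc_window n m (i k : 'I_n) : reverse_hessenberg n m -> (i < k)%N ->
  inc (@hess_poset n m) i k = (i \in window (fun k => m k.+1) k).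
Proof.
case=> lt _ ik; rewrite mem_window ik andbT /inc /hess_poset -!leqNgt.
have -> : i != k by rewrite -val_eqE /= ltn_eqF.
have := lt i.+1; have := ltn_ord i; lia.
Qed.

Lemma inc_sym n (P : rel 'I_n) i k : inc P i k = inc P k i.
Proof. by rewrite /inc eq_sym; congr andb; apply: andbC. Qed.

Lemma inversions_windows n m (f : 'I_n -> nat) : reverse_hessenberg n m ->
  #|[set ij : 'I_n * 'I_n | [&& (ij.1 < ij.2)%N, inc (@hess_poset n m) ij.1 ij.2
      & (f ij.2 < f ij.1)%N]]| =
  (\sum_(k < n) count (fun i => f k < f i)%N (window (fun k => m k.+1) k))%N.
Proof.
move=> hm; rewrite -sum1dep_card big_mkcond /=.
rewrite -(pair_bigA _ (fun i k : 'I_n => if [&& (i < k)%N, inc (@hess_poset n m) i k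
      & (f k < f i)%N] then 1%N else 0%N)) exchange_big /=.
apply: eq_bigr => k _; rewrite count_filter -sum1_count big_enum_cond /= -big_mkcond.
apply: eq_bigl => i /=; case: (ltnP i k) => ik; last by rewrite !andbF.
by rewrite (inc_window hm ik) mem_window ik /= !andbT [LHS]andbC.
Qed.

Section ChromaticImage.
Variables (n N : nat) (m : nat -> nat).
Variables (K : fieldType) (phi : {rmorphism {mpoly {poly int}[N]} -> K}).
Hypothesis hm : reverse_hessenberg n m.
Let q : K := phi ('X%:MP).
Let x (i : 'I_N) : K := phi 'X_i.

Lemma color_esum_mesym k : color_esum x k = phi (mesym N {poly int} k).
Proof.
rewrite /color_esum /mesym rmorph_sum; apply: eq_bigr => S _.
by rewrite rmorph_prod.
Qed.

(** The inversions of a proper colouring are distributed over the larger vertex of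
    each edge. *)
Lemma chromatic_Zsum : phi (chromatic (inc (@hess_poset n m)) N) =
  Zsum (color_weight q x) n (fun k => m k.+1).
Proof.
rewrite /chromatic rmorph_sum big_mkcond /=; apply: eq_bigr => kap _.
rewrite /color_weight big_split /=.
have -> : \prod_(k < n) \prod_(p <- [seq kap i | i <- window (fun k => m k.+1) k])
    color_factor q (kap k) p =
    \prod_(k < n) \prod_(i <- window (fun k => m k.+1) k) color_factor q (kap k) (kap i).
  by apply: eq_bigr => k _; rewrite big_map.
case: (boolP (proper _ kap)) => [prop|].
  rewrite -mul_mpolyC rmorphM rmorph_prod mulrC; congr (_ * _).
  rewrite /coloring_inv (inversions_windows (fun i => nat_of_ord (kap i)) hm) !rmorphXn /= -/q.
  rewrite expr_sum; apply: eq_bigr => k _.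
  rewrite big_seq (eq_bigr (fun i => q ^+ (kap k < kap i)%N)) => [|i ik]; last first.
    rewrite /color_factor; move: (ik); rewrite mem_window => /andP[_ lt_ik].
    rewrite -(inc_window hm lt_ik) in ik.
    move/forallP: prop => /(_ i)/forallP/(_ k); rewrite ik /= => /negPf ->.
    by case: ifP.
  rewrite -big_seq; elim: (window _ k) => [|i s IHs]; first by rewrite big_nil.
  by rewrite big_cons /= exprD IHs.
rewrite negb_forall => /existsP[i]; rewrite negb_forall => /existsP[k].
rewrite negb_imply negbK => /andP[ik /eqP e].
have zero (i' k' : 'I_n) : (i' < k')%N -> inc (@hess_poset n m) i' k' -> kap i' = kap k' ->
    \prod_(k < n) \prod_(i <- window (fun k => m k.+1) k) color_factor q (kap k) (kap i) = 0.
  move=> lt; rewrite (inc_window hm lt) => iw e'; rewrite (bigD1 k') //= (big_rem i' iw) /=.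
  by rewrite {1}/color_factor e' eqxx !mul0r.
case: (ltngtP i k) => [lt|gt|/val_inj eik].
- by rewrite (zero i k) ?mulr0.
- by rewrite (zero k i) ?mulr0 // inc_sym.
- by move: ik; rewrite /inc eik eqxx.
Qed.
End ChromaticImage.

Lemma column_atE n T k : (k < n)%N -> column_at n T k = column_of T k.+1.
Proof. by move=> kn; rewrite /column_at (nth_map 0%N) ?size_iota // nth_iota. Qed.

Lemma marksE m n T k : (k < n)%N ->
  marks m n T k = [seq column_of T i.+1 | i <- iota (m k.+1) (k - m k.+1)].
Proof.
move=> kn; rewrite /marks /columns -map_take take_iota (minn_idPl (ltnW kn)).
rewrite -map_drop drop_iota iotaDl -map_comp.
by apply: eq_map => i /=; rewrite add1n.
Qed.

Lemma tableau_inv_marks n m T : reverse_hessenberg n m ->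
  tableau_inv (@hess_poset n m) T =
  (\sum_(0 <= k < n) count (fun p => column_at n T k < p) (marks m n T k))%N.
Proof.
move=> hm; rewrite /tableau_inv.
rewrite (inversions_windows (fun i => column_of T i.+1) hm) big_mkord.
apply: eq_bigr => k _; rewrite column_atE // marksE //.
have perm : perm_eq (map val (window (fun k => m k.+1) k)) (iota (m k.+1) (k - m k.+1)).
  apply: uniq_perm; rewrite ?iota_uniq //.
    by rewrite map_inj_uniq ?window_uniq //; apply: val_inj.
  move=> i; rewrite mem_iota; apply/mapP/idP => [[i' + ->]|ib].
    by rewrite mem_window /=; lia.
  have i_n : (i < n)%N by have := ltn_ord k; lia.
  by exists (Ordinal i_n) => //; rewrite mem_window /=; lia.
rewrite -(seq.permP (perm_map (fun i => column_of T i.+1) perm)) -map_comp count_map.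
by apply: eq_count => i.
Qed.

Lemma prod_column_at (K : comPzRingType) (G : nat -> K) m n T :
  T \in hikita_tableaux m n ->
  \prod_(0 <= k < n) G (column_at n T k) =
    \prod_(w <- T) \prod_(0 <= i < size w) G i.
Proof.
elim: n T => [|n IHn] T; first by rewrite inE => /eqP->; rewrite [LHS]big_geq // big_nil.
case/hikita_tableauxSP => S [c [hS _ cm cp ->]].
have st := hikita_tableaux_standard hS.
rewrite (add_bottom_shape st cm cp) -IHn // big_nat_recr //=.
rewrite /column_at (columns_add_bottom st cm cp); congr (_ * _).
  by apply: eq_big_nat => k /andP[_ kn]; rewrite nth_rcons size_columns kn.
by rewrite nth_rcons size_columns ltnn eqxx.
Qed.

Section Expansion.
Variables (n N : nat) (m : nat -> nat).
Hypothesis hm : reverse_hessenberg n m.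
Variables (K : fieldType) (phi : {rmorphism {mpoly {poly int}[N]} -> K}).
Hypothesis phi_inj : injective phi.
Let q : K := phi ('X%:MP).
Let e k : K := phi (mesym N {poly int} k).

Lemma phi_eq0 p : (phi p == 0) = (p == 0).
Proof. by rewrite -(inj_eq phi_inj) rmorph0. Qed.

Lemma phi_qint k : qint q k = phi (qint 'X k)%:MP.
Proof. by rewrite /q qint_rmorph qint_rmorph. Qed.

Lemma phi_qint_neq0 k : qint q k.+1 != 0.
Proof. by rewrite phi_qint phi_eq0 mpolyC_eq0 qint_X_neq0. Qed.

Lemma phi_X_neq0 : q != 0.
Proof. by rewrite phi_eq0 mpolyC_eq0 polyX_eq0. Qed.

Lemma phi_X_neq1 : q != 1.
Proof.
rewrite -(rmorph1 phi) (inj_eq phi_inj) -mpolyC1 mpolyC_eq.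
by apply/eqP => /(congr1 (fun p : {poly int} => size p)); rewrite size_polyX size_poly1.
Qed.

Lemma phi_two_neq0 : 2%:R != 0 :> K.
Proof.
rewrite -(rmorph_nat phi) phi_eq0 -mpolyC_nat mpolyC_eq0 -polyC_natr polyC_eq0.
by rewrite pnatr_eq0.
Qed.

(** Chosen so that the product over the cells of a row of length a is [a]! e_a. *)
Definition column_ratio (c : nat) : K := qint q c.+1 * e c.+1 / e c.

Lemma prod_column_ratio a : \prod_(0 <= c < a) column_ratio c = qfact q a * e a.
Proof.
elim: a => [|a IHa]; first by rewrite big_geq // qfact0 mul1r /e mesym0E rmorph1.
rewrite big_nat_recr //= IHa qfactS /column_ratio.
case: (leqP a N) => aN.
  have ea : e a != 0 by rewrite phi_eq0 mesym_neq0.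
  by field.
by rewrite /e !mesym_geqnE ?(leqW aN) // rmorph0 invr0 !(mulr0, mul0r).
Qed.

(** The column weights with [column_ratio] give [a]! e_a on a clique of size a, as
    the colour weights do, so the two sums agree for every mu.  In the sum over
    tableaux, the ratios combine to [lam]! e_lam. *)
Lemma phi_chromatic : phi (chromatic (inc (@hess_poset n m)) N) =
  \sum_(T <- hikita_tableaux m n)
    q ^+ tableau_inv (@hess_poset n m) T * qquot_eval (tableau_quotient m n T) q *
    (qfact_part q (shape T) * phi (elem_sym N (shape T))).
Proof.
have hmu := hess_reverse hm.
rewrite (chromatic_Zsum phi hm).
have cmod := column_weight_modular column_ratio phi_qint_neq0 phi_X_neq0 phi_X_neq1 n.
rewrite (Zsum_eq (color_weight_modular _ _) cmod phi_two_neq0 phi_qint_neq0 phi_X_neq0 _ hmu);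
  last first.
  move=> a an; rewrite color_clique column_clique //; last exact: phi_X_neq1.
  - by rewrite prod_column_ratio color_esum_mesym.
  - exact: phi_qint_neq0.
  - exact: phi_X_neq0.
rewrite -Zrec1; last by case: cmod.
rewrite (hikita_tableaux_Zrec _ _ _ (fun=> 1)) //.
rewrite big_seq [RHS]big_seq; apply: eq_bigr => T hT; rewrite mulr1.
rewrite /word_weight (eq_big_nat _ _ (F2 := fun k => column_ratio (column_at n T k) *
  (q ^+ count (fun p => column_at n T k < p)%N (marks m n T k) *
   step_eval q (marks m n T k) (column_at n T k)))); last first.
  move=> k /andP[_ kn]; have /andP[cM acM] := hikita_tableaux_marks hT kn.
  exact: (column_weight_step _ phi_qint_neq0 phi_X_neq0 phi_X_neq1 cM acM).
rewrite big_split [X in _ * X = _]big_split /= (prod_column_at _ hT).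
rewrite (tableau_inv_marks _ hm) tableau_quotient_eval.
rewrite expr_sum mulrC; congr (_ * _).
rewrite /qfact_part /elem_sym rmorph_prod !big_map -big_split /=.
by apply: eq_bigr => w _; rewrite prod_column_ratio.
Qed.
End Expansion.

(** * Integral coefficients *)

(** A partition of n is a map from n positions to {0, ..., n} with the zeros left
    out, which makes their number visibly finite. *)
Definition partitions (n : nat) : seq (seq nat) :=
  undup [seq lam <- [seq [seq k <- map (fun i => val (f i)) (enum 'I_n) | k != 0%N]
                      | f : {ffun 'I_n -> 'I_n.+1}] | is_partition n lam].

Lemma partition_part n lam k : is_partition n lam -> k \in lam -> (0 < k <= n)%N.
Proof.
case/and3P=> _ /allP ge1 /eqP <- kl; rewrite (ge1 k kl) /=.
elim: lam kl {ge1} => //= j lam IHlam; rewrite inE => /orP[/eqP->|/IHlam le].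
  exact: leq_addr.
exact: leq_trans le (leq_addl _ _).
Qed.

Lemma size_partition n lam : is_partition n lam -> (size lam <= n)%N.
Proof.
case/and3P=> _ + /eqP <-; elim: lam => //= j lam IHlam /andP[j1 /IHlam le].
by rewrite -add1n leq_add.
Qed.

Lemma mem_partitions n lam : (lam \in partitions n) = is_partition n lam.
Proof.
rewrite mem_undup mem_filter andb_idr // => part.
pose f := [ffun i : 'I_n => inord (nth 0%N lam i) : 'I_n.+1].
apply/mapP; exists f; first by rewrite mem_enum.
have -> : [seq val (f i) | i <- enum 'I_n] = lam ++ nseq (n - size lam) 0%N.
  apply: (@eq_from_nth _ 0%N).
    by rewrite size_map size_enum_ord size_cat size_nseq subnKC // size_partition.
  move=> i; rewrite size_map size_enum_ord => i_n.
  rewrite (nth_map (Ordinal i_n)) ?size_enum_ord // ffunE /= nth_enum_ord // nth_cat nth_nseq.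
  case: ltnP => il.
    rewrite inordK // ltnS; have := partition_part part (mem_nth 0%N il).
    by case/andP.
  by rewrite nth_default // inordK // if_same.
rewrite filter_cat (_ : [seq k <- nseq _ _ | _] = [::]) ?cats0.
  apply/esym/all_filterP/allP => k kl.
  by have := partition_part part kl; lia.
by rewrite filter_nseq.
Qed.

Lemma partitions_uniq n : uniq (partitions n).
Proof. exact: undup_uniq. Qed.

Lemma e_expansionE n X c : e_expansion n X c <->
  forall N, X N = \sum_(lam <- partitions n) c lam *: elem_sym N lam.
Proof.
have partE : [set lam | is_partition n lam]%classic = [set` partitions n]%classic.
  by apply/seteqP; split=> lam /=; rewrite mem_partitions.
split=> h N; rewrite h partE; last by rewrite fsbig_seq ?partitions_uniq.
by rewrite -fsbig_seq ?partitions_uniq.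
Qed.

Section Coefficients.
Variables (n : nat).
Local Notation A := {poly int}.

(** The exponents of e_lam as a monomial in e_1, ..., e_n. *)
Definition multiplicities (lam : seq nat) : 'X_{1..n} :=
  [multinom count_mem i.+1 lam | i < n].

Let S := [tuple mesym n A i.+1 | i < n].

Lemma multiplicities_inj lam1 lam2 : is_partition n lam1 -> is_partition n lam2 ->
  multiplicities lam1 = multiplicities lam2 -> lam1 = lam2.
Proof.
move=> p1 p2 e.
have count_eq k : (0 < k <= n)%N -> count_mem k lam1 = count_mem k lam2.
  case: k => // k kn; have := congr1 (fun mm : 'X_{1..n} => mm (Ordinal kn)) e.
  by rewrite !mnmE.
have perm : perm_eq lam1 lam2.
  apply/allP => k; rewrite mem_cat => /orP[] kl; apply/eqP/count_eq.
    exact: partition_part p1 kl.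
  exact: partition_part p2 kl.
case/and3P: p1 => s1 _ _; case/and3P: p2 => s2 _ _.
apply: (sorted_eq (leT := geq)) perm => //.
  exact: rev_trans leq_trans.
by move=> i j; rewrite andbC => /anti_leq.
Qed.

Lemma multiplicities_elem_sym lam : is_partition n lam ->
  'X_[A, multiplicities lam] \mPo S = elem_sym n lam.
Proof.
move=> part; rewrite comp_mpolyX /elem_sym.
rewrite (eq_bigr (fun i : 'I_n => mesym n A i.+1 ^+ count_mem i.+1 lam)); last first.
  by move=> i _; rewrite tnth_map tnth_ord_tuple mnmE.
have : forall k, k \in lam -> (0 < k <= n)%N by move=> k; apply: partition_part.
elim: lam {part} => [|k lam IHlam] parts.
  by rewrite big_nil big1.
rewrite big_cons -IHlam; last by move=> j jl; apply: parts; rewrite inE jl orbT.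
have := parts k (mem_head _ _); case: k {parts} => // k /= kn.
under eq_bigr do rewrite exprD.
rewrite big_split /=; congr (_ * _).
rewrite (bigD1 (Ordinal kn)) //= eqxx expr1 big1 ?mulr1 // => i ik.
by rewrite eqSS; move: ik; rewrite -val_eqE /= eq_sym => /negPf->.
Qed.

Lemma elem_sym_symmetric lam : elem_sym n lam \is symmetric.
Proof. by rewrite /elem_sym rpred_prod // => k _; apply: mesym_sym. Qed.

Lemma elem_sym_unique (c1 c2 : seq nat -> A) :
    \sum_(lam <- partitions n) c1 lam *: elem_sym n lam =
    \sum_(lam <- partitions n) c2 lam *: elem_sym n lam ->
  forall lam, is_partition n lam -> c1 lam = c2 lam.
Proof.
pose t (c : seq nat -> A) : {mpoly A[n]} :=
  \sum_(lam <- partitions n) c lam *: 'X_[multiplicities lam].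
have tE c : t c \mPo S = \sum_(lam <- partitions n) c lam *: elem_sym n lam.
  rewrite /t raddf_sum /= big_seq [RHS]big_seq; apply: eq_bigr => lam.
  by rewrite mem_partitions => part; rewrite linearZ /= multiplicities_elem_sym.
have coefE c lam : is_partition n lam -> (t c)@_(multiplicities lam) = c lam.
  move=> part; rewrite /t raddf_sum /= (bigD1_seq lam) ?partitions_uniq ?mem_partitions //=.
  rewrite mcoeffZ mcoeffX eqxx mulr1 big_seq_cond big1 ?addr0 // => mu /andP[].
  rewrite mem_partitions => part' ne; rewrite mcoeffZ mcoeffX.
  case: eqP => [/(multiplicities_inj part' part) e|]; last by rewrite mulr0.
  by rewrite e eqxx in ne.
rewrite -!tE => /msym_fundamental_un e lam part.
by rewrite -(coefE c1) // e coefE.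
Qed.

(** As D is nonzero, f is symmetric too, hence a polynomial in e_1, ..., e_n with
    coefficients in Z[q]; the algebraic independence of the e_i identifies D
    times these with the P lam. *)
Lemma symmetric_expansion (D : A) (P : seq nat -> A) (f : {mpoly A[n]}) :
    D != 0 -> D *: f = \sum_(lam <- partitions n) P lam *: elem_sym n lam ->
  exists c, forall lam, is_partition n lam -> D * c lam = P lam.
Proof.
move=> D0 Df.
have D_inj (g : {mpoly A[n]}) : D *: g = 0 -> g = 0.
  by move/eqP; rewrite -mul_mpolyC mulf_eq0 mpolyC_eq0 (negPf D0) /= => /eqP.
have f_sym : f \is symmetric.
  have Df_sym : D *: f \is symmetric.
    by rewrite Df rpred_sum // => lam _; rewrite rpredZ // elem_sym_symmetric.
  apply/issymP => s; apply/eqP; rewrite -subr_eq0; apply/eqP/D_inj.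
  move/issymP: Df_sym => /(_ s); rewrite linearZ /= => e.
  by rewrite scalerBr e subrr.
have [t [tS _]] := sym_fundamental f_sym.
exists (fun lam => t@_(multiplicities lam)) => lam part.
have : D *: t = \sum_(lam <- partitions n) P lam *: 'X_[multiplicities lam].
  apply: msym_fundamental_un; rewrite linearZ /= tS Df raddf_sum /=.
  rewrite big_seq [RHS]big_seq; apply: eq_bigr => mu.
  by rewrite mem_partitions => part'; rewrite linearZ /= multiplicities_elem_sym.
move/(congr1 (mcoeff (multiplicities lam))); rewrite mcoeffZ => ->.
rewrite raddf_sum /= (bigD1_seq lam) ?partitions_uniq ?mem_partitions //=.
rewrite mcoeffZ mcoeffX eqxx mulr1 big_seq_cond big1 ?addr0 // => mu /andP[].
rewrite mem_partitions => part' ne; rewrite mcoeffZ mcoeffX.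
case: eqP => [/(multiplicities_inj part' part) e|]; last by rewrite mulr0.
by rewrite e eqxx in ne.
Qed.
End Coefficients.

(** * Clearing denominators *)

Lemma qfact_part_rmorph (R S : pzRingType) (f : {rmorphism R -> S}) q lam :
  qfact_part (f q) lam = f (qfact_part q lam).
Proof.
rewrite /qfact_part rmorph_prod; apply: eq_bigr => k _.
by rewrite /qfact rmorph_prod; apply: eq_bigr => i _; rewrite qint_rmorph.
Qed.

Definition quot_num (h : qquot) : {poly int} := \prod_(k <- qnum h) qint 'X k.
Definition quot_den (h : qquot) : {poly int} := \prod_(k <- qden h) qint 'X k.

Lemma quot_den_neq0 h : quot_den h != 0.
Proof.
rewrite prodf_seq_neq0; apply/allP => k kh /=; have := allP (qden_gt0 h) k kh.
by case: k {kh} => // k _; rewrite qint_X_neq0.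
Qed.

Lemma quot_eval_clear (F : fieldType) (f : {rmorphism {poly int} -> F}) h :
  injective f -> qquot_eval h (f 'X) * f (quot_den h) = f (quot_num h).
Proof.
move=> f_inj; have den0 : f (quot_den h) != 0.
  by rewrite -(rmorph0 f) (inj_eq f_inj) quot_den_neq0.
have fE s : \prod_(k <- s) qint (f 'X) k = f (\prod_(k <- s) qint 'X k).
  by rewrite rmorph_prod; apply: eq_bigr => k _; rewrite qint_rmorph.
by rewrite /qquot_eval !fE divfK.
Qed.

Section Denominators.
Variables (n : nat) (m : nat -> nat).
Hypothesis hm : reverse_hessenberg n m.
Let hik := hikita_tableaux m n.
Let h := tableau_quotient m n.
Let inv := tableau_inv (@hess_poset n m).

Definition common_den : {poly int} := \prod_(T <- hik) quot_den (h T).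

Definition cleared_num (T : tableau) : {poly int} :=
  quot_num (h T) * \prod_(T' <- rem T hik) quot_den (h T').

(** The coefficient of e_lam, times the common denominator: this moves the
    identity from a field of fractions to polynomials over Z[q]. *)
Definition cleared_coef (lam : seq nat) : {poly int} :=
  \sum_(T <- hik | shape T == lam) 'X ^+ inv T * cleared_num T * qfact_part 'X lam.

Lemma common_den_neq0 : common_den != 0.
Proof. by rewrite prodf_seq_neq0; apply/allP => T _; apply: quot_den_neq0. Qed.

Lemma common_den_clear (F : fieldType) (f : {rmorphism {poly int} -> F}) T :
    injective f -> T \in hik ->
  qquot_eval (h T) (f 'X) * f common_den = f (cleared_num T).
Proof.
move=> f_inj hT; rewrite /common_den (big_rem T hT) /= rmorphM mulrA.
by rewrite quot_eval_clear // -rmorphM.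
Qed.

(** [phi_chromatic] in the field of fractions of the polynomials in N variables,
    multiplied by the common denominator. *)
Lemma cleared_expansion N : common_den *: chromatic (inc (@hess_poset n m)) N =
  \sum_(lam <- partitions n) cleared_coef lam *: elem_sym N lam.
Proof.
pose phi : {rmorphism {mpoly {poly int}[N]} -> {fraction {mpoly {poly int}[N]}}} := @tofrac _.
have phi_inj : injective phi by move=> a b /eqP; rewrite tofrac_eq => /eqP.
pose incl : {rmorphism {poly int} -> {fraction {mpoly {poly int}[N]}}} := phi \o @mpolyC N _.
have incl_inj : injective incl by move=> a b /phi_inj /eqP; rewrite mpolyC_eq => /eqP.
transitivity (\sum_(T <- hik)
    ('X ^+ inv T * cleared_num T * qfact_part 'X (shape T)) *: elem_sym N (shape T)).
  have /phi_inj-> // : phi (common_den *: chromatic (inc (@hess_poset n m)) N) =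
      phi (\sum_(T <- hik)
    ('X ^+ inv T * cleared_num T * qfact_part 'X (shape T)) *: elem_sym N (shape T)).
  rewrite -mul_mpolyC rmorphM (phi_chromatic hm phi_inj) mulr_sumr rmorph_sum.
  rewrite big_seq [RHS]big_seq; apply: eq_bigr => T hT.
  rewrite -mul_mpolyC [RHS]rmorphM.
  have inclE p : phi p%:MP = incl p by [].
  rewrite !inclE [incl (_ * qfact_part _ _)]rmorphM [incl ('X ^+ _ * _)]rmorphM.
  rewrite -(common_den_clear incl_inj hT) [incl ('X ^+ _)]rmorphXn -qfact_part_rmorph.
  by rewrite /h /inv; ring.
under [RHS]eq_bigr do rewrite scaler_suml.
rewrite (exchange_big_dep xpredT) //= big_seq [RHS]big_seq; apply: eq_bigr => T hT.
have shT : shape T \in partitions n.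
  by rewrite mem_partitions; case/and4P: (hikita_tableaux_standard hT).
rewrite big_mkcond (bigD1_seq (shape T)) ?partitions_uniq //= eqxx big1 ?addr0 // => lam.
by rewrite eq_sym => /negPf->.
Qed.

(** The case of n variables gives integral coefficients and their uniqueness; with
    these coefficients the expansion holds in any number of variables. *)
Lemma chromatic_coefE lam : is_partition n lam ->
  common_den * chromatic_coef (@hess_poset n m) lam = cleared_coef lam.
Proof.
set X := chromatic (inc (@hess_poset n m)).
have [c cE] := symmetric_expansion common_den_neq0 (cleared_expansion n).
have c_exp : e_expansion n X c.
  apply/e_expansionE => N; have : common_den *: X N = common_den *:
      \sum_(lam <- partitions n) c lam *: elem_sym N lam.
    rewrite cleared_expansion scaler_sumr big_seq [RHS]big_seq; apply: eq_bigr => mu.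
    by rewrite mem_partitions => part; rewrite scalerA cE.
  rewrite -!mul_mpolyC => /mulfI; apply.
  by rewrite mpolyC_eq0 common_den_neq0.
have /e_expansionE ex : e_expansion n X (xget (fun=> 0) [set c | e_expansion n X c]%classic).
  by apply: (@xgetPex _ _ [set c | e_expansion n X c]%classic); exists c.
apply: (@elem_sym_unique n (fun lam => common_den * chromatic_coef (@hess_poset n m) lam)).
rewrite -cleared_expansion -/X [X n]ex scaler_sumr.
by apply: eq_bigr => mu _; rewrite scalerA.
Qed.
End Denominators.

Theorem theorem1p7 (R : realType) (n : nat) (m : nat -> nat) (lam : seq nat)
  (hm : reverse_hessenberg n m) (hlam : is_partition n lam) :
  exists h : tableau -> qquot,
    (forall T, HikSYT n m lam T ->
       forall tau : R, 0 <= tau -> 0 < qquot_eval (h T) tau <= 1) /\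
    tofrac (chromatic_coef (@hess_poset n m) lam) / qfact_part qvar lam =
      \sum_(T \in HikSYT n m lam)
        qvar ^+ tableau_inv (@hess_poset n m) T * qquot_eval (h T) qvar.
Proof.
exists (tableau_quotient m n); rewrite HikSYT_E; split.
  move=> T; rewrite /= mem_filter => /andP[_ hT] tau tau_ge0.
  have bound (k : 'I_n) : 0 < step_eval tau (marks m n T k) (column_at n T k) <= 1.
    apply: step_eval_bound => //.
      exact: hikita_tableaux_uniq_marks (hess_reverse hm) hT (ltn_ord k).
    by case/andP: (hikita_tableaux_marks hT (ltn_ord k)).
  rewrite tableau_quotient_eval big_mkord prodr_gt0 => [|k _]; last by case/andP: (bound k).
  by apply: prodr_ile1 => k _; case/andP: (bound k) => /ltW -> ->.
rewrite -fsbig_seq ?filter_uniq ?hikita_tableaux_uniq // big_filter.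
pose f : {rmorphism {poly int} -> Qq} := @tofrac _.
have f_inj : injective f by move=> a b /eqP; rewrite tofrac_eq => /eqP.
have D0 : f (common_den n m) != 0 by rewrite tofrac_eq0 common_den_neq0.
have qf0 : qfact_part qvar lam != 0.
  rewrite prodf_seq_neq0; apply/allP => k _ /=; rewrite prodf_seq_neq0.
  by apply/allP => i; rewrite mem_index_iota => /andP[i0 _]; rewrite qint_qvar_neq0.
apply: (mulfI D0); apply: (mulIf qf0); rewrite -mulrA divfK //.
rewrite -[tofrac _]/(f _) -rmorphM (chromatic_coefE hm hlam) rmorph_sum.
rewrite mulr_sumr mulr_suml big_seq_cond [RHS]big_seq_cond.
apply: eq_bigr => T /andP[hT /eqP shT].
rewrite [f (_ * qfact_part _ _)]rmorphM [f ('X ^+ _ * _)]rmorphM.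
rewrite -(common_den_clear f_inj hT) [f ('X ^+ _)]rmorphXn -qfact_part_rmorph.
by rewrite -[f 'X]/qvar; ring.
Qed.
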